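(* Under the resonance condition, the comultiplication rule makes the subspace $W^{k,r,N}(u)\subset W^N(u)$ into an $\mathcal E$-module of level $(1,1)$. That is, the operators $e(z),f(z),\psi^\pm(z)$ on $W^{k,r,N}(u)$ whose matrix coefficients between the vectors $|\lambda\rangle$, $\lambda\in S^{k,r,N}$, are induced from those on $W^N(u)$ for generic parameters are well defined, preserve $W^{k,r,N}(u)$, and satisfy the relations of $\mathcal E$, with $\psi_0^\pm$ acting by $1$.
   Context: Let $k\ge1$, $r\ge2$ be integers, $u\in\mathbb C^\times$, and $q_1,q_2,q_3\in\mathbb C^\times$ with $q_1q_2q_3=1$ satisfying the resonance condition $q_1^{1-r}q_3^{k+1}=1$, and such that $q_1^nq_3^m=1$ ($n,m\in\mathbb Z$) if and only if there is an integer $\alpha$ with $n=(1-r)\alpha$, $m=(k+1)\alpha$. Put $g(z,w)=(z-q_1w)(z-q_2w)(z-q_3w)$. $\mathcal E$ is the unital associative $\mathbb C$-algebra generated by $e_i,f_i$ ($i\in\mathbb Z$), $\psi^+_j,\psi^-_{-j}$ ($j>0$) and $(\psi_0^{\pm})^{\pm1}$. With $e(z)=\sum_{i\in\mathbb Z}e_iz^{-i}$, $f(z)=\sum_{i\in\mathbb Z}f_iz^{-i}$, $\psi^\pm(z)=\sum_{\pm i\ge0}\psi^\pm_iz^{-i}$, $\delta(z)=\sum_{n\in\mathbb Z}z^n$, the defining relations (coefficientwise) are $$g(z,w)e(z)e(w)=-g(w,z)e(w)e(z),\quad g(w,z)f(z)f(w)=-g(z,w)f(w)f(z),$$ $$g(z,w)\psi^\pm(z)e(w)=-g(w,z)e(w)\psi^\pm(z),\quad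 g(w,z)\psi^\pm(z)f(w)=-g(z,w)f(w)\psi^\pm(z),$$ $$[e(z),f(w)]=\frac{\delta(z/w)}{g(1,1)}(\psi^+(z)-\psi^-(z)),\quad [\psi^\pm_i,\psi^\pm_j]=0,\ [\psi^\pm_i,\psi^\mp_j]=0,$$ $$\psi^\pm_0(\psi^\pm_0)^{-1}=(\psi^\pm_0)^{-1}\psi^\pm_0=1,\quad [e_0,[e_1,e_{-1}]]=0,\quad [f_0,[f_1,f_{-1}]]=0.$$ A module has level $(l_+,l_-)$ if $\psi_0^\pm$ act by the scalars $l_\pm$. Let $\mathcal P^N=\{\lambda\in\mathbb Z^N\mid\lambda_1\ge\dots\ge\lambda_N\}$, and let $W^N(u)$ be the space with basis $|\lambda\rangle=[u]_{\lambda_1}\otimes[uq_2^{-1}]_{\lambda_2-1}\otimes\dots\otimes[uq_2^{-N+1}]_{\lambda_N-N+1}$, $\lambda\in\mathcal P^N$, inside the tensor product of vector representations. For generic parameters $q_i$ the action obtained from the comultiplication is, with $\lambda\pm\mathbf 1_i=(\lambda_1,\dots,\lambda_i\pm1,\dots,\lambda_N)$, $$(1-q_1)e(z)|\lambda\rangle=\sum_{i=1}^N\prod_{j=1}^{i-1}\frac{(1-q_1^{\lambda_i-\lambda_j}q_3^{i-j-1})(1-q_1^{\lambda_i-\lambda_j+1}q_3^{i-j+1})}{(1-q_1^{\lambda_i-\lambda_j}q_3^{i-j})(1-q_1^{\lambda_i-\lambda_j+1}q_3^{i-j})}\delta(q_1^{\lambda_i}q_3^{i-1}u/z)|\lambda+\mathbf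 1_i\rangle,$$ $$-(1-q_1^{-1})f(z)|\lambda\rangle=\sum_{i=1}^N\prod_{j=i+1}^N\frac{(1-q_1^{\lambda_j-\lambda_i+1}q_3^{j-i+1})(1-q_1^{\lambda_j-\lambda_i}q_3^{j-i-1})}{(1-q_1^{\lambda_j-\lambda_i+1}q_3^{j-i})(1-q_1^{\lambda_j-\lambda_i}q_3^{j-i})}\delta(q_1^{\lambda_i-1}q_3^{i-1}u/z)|\lambda-\mathbf 1_i\rangle,$$ $$\psi^\pm(z)|\lambda\rangle=\Big(\prod_{i=1}^N\frac{(1-q_1^{\lambda_i}q_3^{i}u/z)(1-q_1^{\lambda_i-1}q_3^{i-2}u/z)}{(1-q_1^{\lambda_i}q_3^{i-1}u/z)(1-q_1^{\lambda_i-1}q_3^{i-1}u/z)}\Big)^\pm|\lambda\rangle,$$ where $\gamma(z)^\pm$ is the expansion in powers of $z^{\mp1}$ and terms with $\lambda\pm\mathbf 1_i\notin\mathcal P^N$ are absent (their coefficients vanish). In the resonance case the matrix coefficients are defined by first cancelling the factors that vanish under the resonance condition if they appear simultaneously in numerator and denominator, and then imposing the resonance condition. $S^{k,r,N}=\{\lambda\in\mathcal P^N\mid\lambda_i-\lambda_{i+k}\ge r\ (1\le i\le N-k)\}$ (the $(k,r)$-admissible partitions), and $W^{k,r,N}(u)=\mathrm{span}\{|\lambda\rangle\mid\lambda\in S^{k,r,N}\}$. *)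

(* Defs.v *)
From HB Require Import structures.
From mathcomp Require Import all_boot all_order all_algebra.
From mathcomp Require Import finmap monalg.
From mathcomp Require Import reals complex.

Set Implicit Arguments.
Unset Strict Implicit.
Unset Printing Implicit Defensive.

Import Order.TTheory GRing.Theory Num.Theory.
Local Open Scope ring_scope.

Section FreeModule.
Variables (F : fieldType) (K : choiceType).
Implicit Types (f : K -> {malg F[K]}) (w : {malg F[K]}).

Definition linext_fun f w : {malg F[K]} := \sum_(l <- msupp w) w@_l *: f l.

Lemma linext_fun_is_linear f : linear (linext_fun f).
Proof.
have extE (D : {fset K}) w : {subset msupp w <= D} ->
    linext_fun f w = \sum_(l <- D) w@_l *: f l.
  move=> sD; apply: big_fset_incl => [|l _ lw]; first by apply/fsubsetP.
  by rewrite mcoeff_outdom ?scale0r.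
move=> a v w.
pose D := (msupp v `|` msupp w `|` msupp (a *: v + w))%fset.
have sD1 : {subset msupp v <= D} by move=> l lv; rewrite /D !inE lv.
have sD2 : {subset msupp w <= D} by move=> l lw; rewrite /D !inE lw orbT.
have sD3 : {subset msupp (a *: v + w) <= D}.
  by move=> l lvw; rewrite /D !inE lvw orbT.
rewrite !(extE D) // scaler_sumr -big_split /=.
by apply: eq_bigr => l _; rewrite mcoeffD mcoeffZ scalerDl scalerA.
Qed.

HB.instance Definition _ f :=
  GRing.isLinear.Build F {malg F[K]} {malg F[K]} *:%R (linext_fun f)
    (linext_fun_is_linear f).

(* The linear map sending the basis vector << l >> to f l. *)
Definition linext f : {linear {malg F[K]} -> {malg F[K]}} := linext_fun f.

Definition span_of (S : pred K) (w : {malg F[K]}) : Prop :=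
  exists (s : seq K) (c : K -> F),
    all S s /\ w = \sum_(l <- s) c l *: << l >>.

End FreeModule.

(* Modules over the algebra E: a module over an algebra given by generators   *)
(* and relations is a space with one operator per generator, these operators  *)
(* satisfying the relations.                                                  *)
Section QuantumToroidalModule.
Variables (F : fieldType) (q1 q2 q3 : F) (V : lmodType F).

(* act_psip j is psi^+_j and act_psim j is psi^-_{-j}, for j >= 0;            *)
(* act_psip0V and act_psim0V are (psi^+_0)^{-1} and (psi^-_0)^{-1}.           *)
Record E_action := EAction {
  act_e : int -> {linear V -> V};
  act_f : int -> {linear V -> V};
  act_psip : nat -> {linear V -> V};
  act_psim : nat -> {linear V -> V};
  act_psip0V : {linear V -> V};
  act_psim0V : {linear V -> V} }.

(* The coefficients of z^{-i} in psi^+(z) and psi^-(z), for all i in Z. *)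
Definition psip_coef (A : E_action) (i : int) (v : V) : V :=
  if 0 <= i then act_psip A `|i|%N v else 0.
Definition psim_coef (A : E_action) (i : int) (v : V) : V :=
  if i <= 0 then act_psim A `|i|%N v else 0.

(* g is homogeneous of degree 3: g(z, w) = w^3 G(z/w) with G = gpoly, so that *)
(* g(z, w) = \sum_(s < 4) G_s z^s w^(3 - s) and g(1, 1) = G(1).               *)
Definition gpoly : {poly F} :=
  ('X - q1%:P) * ('X - q2%:P) * ('X - q3%:P).

(* If X m n is the coefficient of z^{-m} w^{-n} in a series X(z, w), then     *)
(* gzw X m n and gwz X m n are the coefficients of z^{-m} w^{-n} in           *)
(* g(z, w) X(z, w) and in g(w, z) X(z, w) respectively.                       *)
Definition gzw (X : int -> int -> V) (m n : int) : V :=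
  \sum_(s < 4) gpoly`_s *: X (m + s%:Z) (n + (3 - s)%N%:Z).
Definition gwz (X : int -> int -> V) (m n : int) : V :=
  \sum_(s < 4) gpoly`_s *: X (m + (3 - s)%N%:Z) (n + s%:Z).

Definition comm_op (A B : V -> V) (v : V) : V := A (B v) - B (A v).

(* U is stable under the operators of A and these operators, restricted to U, *)
(* satisfy the relations of E.                                                *)
Record is_E_module (U : V -> Prop) (A : E_action) : Prop := IsEModule {
  stable_e : forall i v, U v -> U (act_e A i v);
  stable_f : forall i v, U v -> U (act_f A i v);
  stable_psip : forall j v, U v -> U (act_psip A j v);
  stable_psim : forall j v, U v -> U (act_psim A j v);
  stable_psip0V : forall v, U v -> U (act_psip0V A v);
  stable_psim0V : forall v, U v -> U (act_psim0V A v);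
  rel_ee : forall m n v, U v ->
    gzw (fun i j => act_e A i (act_e A j v)) m n =
    - gwz (fun i j => act_e A j (act_e A i v)) m n;
  rel_ff : forall m n v, U v ->
    gwz (fun i j => act_f A i (act_f A j v)) m n =
    - gzw (fun i j => act_f A j (act_f A i v)) m n;
  rel_psip_e : forall m n v, U v ->
    gzw (fun i j => psip_coef A i (act_e A j v)) m n =
    - gwz (fun i j => act_e A j (psip_coef A i v)) m n;
  rel_psim_e : forall m n v, U v ->
    gzw (fun i j => psim_coef A i (act_e A j v)) m n =
    - gwz (fun i j => act_e A j (psim_coef A i v)) m n;
  rel_psip_f : forall m n v, U v ->
    gwz (fun i j => psip_coef A i (act_f A j v)) m n =
    - gzw (fun i j => act_f A j (psip_coef A i v)) m n;
  rel_psim_f : forall m n v, U v ->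
    gwz (fun i j => psim_coef A i (act_f A j v)) m n =
    - gzw (fun i j => act_f A j (psim_coef A i v)) m n;
  (* delta(z/w) psi(z) has z^{-m} w^{-n} coefficient psi_{m + n} *)
  rel_ef : forall m n v, U v ->
    comm_op (act_e A m) (act_f A n) v =
    (gpoly.[1])^-1 *: (psip_coef A (m + n) v - psim_coef A (m + n) v);
  rel_psip_psip : forall i j v, U v ->
    comm_op (act_psip A i) (act_psip A j) v = 0;
  rel_psim_psim : forall i j v, U v ->
    comm_op (act_psim A i) (act_psim A j) v = 0;
  rel_psip_psim : forall i j v, U v ->
    comm_op (act_psip A i) (act_psim A j) v = 0;
  rel_psip0V : forall v, U v ->
    act_psip A 0%N (act_psip0V A v) = v /\ act_psip0V A (act_psip A 0%N v) = v;
  rel_psim0V : forall v, U v ->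
    act_psim A 0%N (act_psim0V A v) = v /\ act_psim0V A (act_psim A 0%N v) = v;
  rel_serre_e : forall v, U v ->
    comm_op (act_e A 0) (comm_op (act_e A 1) (act_e A (-1))) v = 0;
  rel_serre_f : forall v, U v ->
    comm_op (act_f A 0) (comm_op (act_f A 1) (act_f A (-1))) v = 0 }.

Definition has_level (U : V -> Prop) (A : E_action) (lp lm : F) : Prop :=
  forall v, U v -> act_psip A 0%N v = lp *: v /\ act_psim A 0%N v = lm *: v.

End QuantumToroidalModule.

(* The n-th coefficient of the power series expansion of num / den at 0, for  *)
(* den with nonzero constant term, by long division.                          *)
Fixpoint pexpand (F : fieldType) (num den : {poly F}) (n : nat) : F :=
  let c := num`_0 / den`_0 in
  if n is n'.+1 then pexpand (drop_poly 1 (num - c *: den)) den n' else c.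

Lemma pexpandP (F : fieldType) (num den : {poly F}) (n : nat) :
  den`_0 != 0 ->
  \sum_(i < n.+1) pexpand num den i * den`_(n - i) = num`_n.
Proof.
move=> d0; elim: n num => [|n IHn] num.
  by rewrite big_ord1 /= mulfVK.
rewrite big_ord_recl subn0.
under eq_bigr => i _ do rewrite lift0 subSS.
rewrite IHn coef_drop_poly coefB coefZ addn1.
by case: n {IHn} => [|n] /=; rewrite addrC subrK.
Qed.

(* Formal fractions of products of factors 1 - q1^a q3^b, such a factor being *)
(* represented by the pair of exponents (a, b).                               *)
Record qfrac := QFrac { qnum : seq (int * int); qden : seq (int * int) }.

(* Difference of multisets. *)
Definition seqD (T : eqType) (s t : seq T) : seq T :=
  foldl (fun s' x => rem x s') s t.

Section Resonance.
Variables (F : fieldType) (q1 q3 : F).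

Definition qfactor (p : int * int) : F := 1 - q1 ^ p.1 * q3 ^ p.2.

Definition qvanish (p : int * int) : bool := qfactor p == 0.

(* Cancel the factors that vanish at (q1, q3) and occur (with multiplicity)   *)
(* in both the numerator and the denominator.                                 *)
Definition qcancel (x : qfrac) : qfrac :=
  QFrac (seqD (qnum x) (filter qvanish (qden x)))
        (seqD (qden x) (filter qvanish (qnum x))).

Definition qregular (x : qfrac) : Prop :=
  \prod_(p <- qden (qcancel x)) qfactor p != 0.

Definition qvalue (x : qfrac) : F :=
  (\prod_(p <- qnum (qcancel x)) qfactor p) /
  (\prod_(p <- qden (qcancel x)) qfactor p).

End Resonance.

(* The tensor product of N vector representations has the basis |lambda>,     *)
(* lambda in Z^N.  Indices i : 'I_N start from 0, so that i is i.+1 in the    *)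
(* usual numbering lambda_1, ..., lambda_N.                                   *)
Section VectorTensor.
Variable N : nat.

Local Notation weight := {ffun 'I_N -> int}.
Implicit Types (l : weight) (i j : 'I_N).

Definition is_partition : pred weight := fun l =>
  [forall i : 'I_N, forall j : 'I_N, (i <= j)%N ==> (l j <= l i)].

Definition admissible (k r : nat) : pred weight := fun l =>
  is_partition l &&
  [forall i : 'I_N, forall j : 'I_N,
    (j == (i + k)%N :> nat) ==> (r%:Z <= l i - l j)].

Definition wunit i : weight := [ffun j => (i == j)%:Z].

Definition pair_num l i j : seq (int * int) :=
  [:: (l i - l j, i%:Z - j%:Z - 1); (l i - l j + 1, i%:Z - j%:Z + 1)].
Definition pair_den l i j : seq (int * int) :=
  [:: (l i - l j, i%:Z - j%:Z); (l i - l j + 1, i%:Z - j%:Z)].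

Definition e_frac l i : qfrac :=
  QFrac (flatten [seq pair_num l i j | j <- enum 'I_N & (j < i)%N])
        (flatten [seq pair_den l i j | j <- enum 'I_N & (j < i)%N]).
Definition f_frac l i : qfrac :=
  QFrac (flatten [seq pair_num l j i | j <- enum 'I_N & (i < j)%N])
        (flatten [seq pair_den l j i | j <- enum 'I_N & (i < j)%N]).

Variables (F : fieldType) (q1 q3 u : F).

Definition ket l : {malg F[weight]} := << l >>.

(* Coefficient of z^{-n}; delta(a/z) contributes a^n.  The terms with         *)
(* l + wunit i (resp. l - wunit i) not a partition are not discarded: their   *)
(* coefficient contains a factor 1 - q1^0 q3^0, with j next to i.             *)
Definition e_ket (n : int) l : {malg F[weight]} :=
  (1 - q1)^-1 *: \sum_(i < N)
    (qvalue q1 q3 (e_frac l i) * (q1 ^ l i * q3 ^ i%:Z * u) ^ n)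
      *: ket (l + wunit i).

Definition f_ket (n : int) l : {malg F[weight]} :=
  (- (1 - q1^-1))^-1 *: \sum_(i < N)
    (qvalue q1 q3 (f_frac l i) * (q1 ^ (l i - 1) * q3 ^ i%:Z * u) ^ n)
      *: ket (l - wunit i).

(* The eigenvalue of psi(z) on |l> is the product over i of                   *)
(*   (1 - psi_a l i / z) (1 - psi_b l i / z)                                  *)
(*     / ((1 - psi_c l i / z) (1 - psi_d l i / z)).                           *)
Definition psi_a l i : F := q1 ^ l i * q3 ^ (i%:Z + 1) * u.
Definition psi_b l i : F := q1 ^ (l i - 1) * q3 ^ (i%:Z - 1) * u.
Definition psi_c l i : F := q1 ^ l i * q3 ^ i%:Z * u.
Definition psi_d l i : F := q1 ^ (l i - 1) * q3 ^ i%:Z * u.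

(* Coefficient of z^{-n} in the expansion in powers of z^{-1}. *)
Definition psip_eig (n : nat) l : F :=
  pexpand (\prod_(i < N) ((1 - psi_a l i *: 'X) * (1 - psi_b l i *: 'X)))
          (\prod_(i < N) ((1 - psi_c l i *: 'X) * (1 - psi_d l i *: 'X))) n.

(* Coefficient of z^n in the expansion in powers of z; numerator and          *)
(* denominator have been multiplied by z^(2N).                                *)
Definition psim_eig (n : nat) l : F :=
  pexpand (\prod_(i < N) (('X - (psi_a l i)%:P) * ('X - (psi_b l i)%:P)))
          (\prod_(i < N) (('X - (psi_c l i)%:P) * ('X - (psi_d l i)%:P))) n.

Definition W_action : E_action {malg F[weight]} :=
  {| act_e := fun n => linext (e_ket n);
     act_f := fun n => linext (f_ket n);
     act_psip := fun n => linext (fun l => psip_eig n l *: ket l);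
     act_psim := fun n => linext (fun l => psim_eig n l *: ket l);
     act_psip0V := linext (fun l => (psip_eig 0%N l)^-1 *: ket l);
     act_psim0V := linext (fun l => (psim_eig 0%N l)^-1 *: ket l) |}.

Definition Wkr (k r : nat) : {malg F[weight]} -> Prop :=
  span_of (admissible k r).

End VectorTensor.

(* Main.v *)
Require Import Defs.
From HB Require Import structures.
From mathcomp Require Import all_boot all_order all_algebra.
From mathcomp Require Import finmap monalg.
From mathcomp Require Import reals complex.
From mathcomp Require Import zify ring.

Set Implicit Arguments.
Unset Strict Implicit.
Unset Printing Implicit Defensive.

Import Order.TTheory GRing.Theory Num.Theory.
Local Open Scope ring_scope.

(** Write [x_i] for the position [q1 ^ l_i * q3 ^ i * u] of column [i] of the
    weight [l].  All matrix coefficients are products over pairs of columns of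
    values of one rational function: adding a box to column [i] has coefficient
    [\prod_(j < i) omega (x_i / x_j)], removing one has coefficient
    [\prod_(j > i) omega (x_j / x_i)], and the eigenvalue of [psi] is a product
    of factors depending on one [x_i] each.  For generic parameters every
    relation is then an identity between rational functions of the [x_i].  The
    work is to see that each identity survives at the resonance.

    Poles.  On an admissible partition a denominator vanishes only at a tight
    pair: columns [j] and [i = j + k + 1] with [l_j = l_i + r].  Admissibility
    then forces [l_(j+1) = l_j] and [l_(i-1) = l_i].  The first equality cancels
    the pole, the second one leaves another zero, so the coefficient of adding a
    box to column [i] is zero there ([e_fracP]).  Since division by zero gives
    zero, the cancelled coefficient is on every admissible partition the plain
    product of the [omega (x_i / x_j)].  It vanishes as soon as adding the box
    destroys admissibility ([e_coef_not_adm]), which gives stability and allows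
    intermediate weights outside the admissible set to be ignored.

    Relations among the [e]'s.  A path that fills the lower column of a tight
    pair must fill four different columns before it can end at an admissible
    partition ([tight_four_boxes]).  With two or three boxes the denominators
    that matter are therefore nonzero when the target is admissible, and every
    path has coefficient zero otherwise.  Exchanging two boxes is the identity
    [omega_exchange] ([e_exchange]).  In the cubic relation a path contributes,
    up to a common factor, its weight times three values of [g], with the sign
    of the order of its boxes; the sum over the six orders is a polynomial
    identity ([serre_alternating], [serre_orbit_eq0]).

    Relations among the [f]'s.  The involution [l_i |-> - l_(N-1-i)] inverts the
    positions and conjugates [f_n] into an operator with the matrix coefficients
    of [e_(-n)] for another value of [u] ([dual_f_basis]).

    Relations with [psi].  Adding a box multiplies the eigenvalue by
    [- g(x, z) / g(z, x)]; this identity of rational functions holds for both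
    expansions ([psip_exchange], [psim_exchange]).  In [[e, f]] the off-diagonal
    terms cancel in pairs ([ef_coef_exchange]), and the diagonal ones are the
    residues of the eigenvalue of [psi], whose sum against powers of the poles
    is the difference of the two expansions ([pexpand_difference]).  At a tight
    pair two simple poles collide, but two zeros of the numerator sit at the
    same point ([multiple_pole_cancels]): the colliding poles disappear, in
    accordance with the vanishing of the matrix coefficients. *)

(** * Linear operators and spans *)

Section FreeModuleTheory.
Variables (F : fieldType) (K : choiceType).
Implicit Types (f : K -> {malg F[K]}) (v w : {malg F[K]}) (S : pred K).

Lemma linext_basis f l : linext f << l >> = f l.
Proof.
rewrite /linext /= /linext_fun msuppU oner_eq0 big_seq_fset1.
by rewrite mcoeffUU scale1r.
Qed.

Lemma span_ofP S w : span_of S w <-> {in msupp w, forall l, S l}.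
Proof.
split=> [[s [c [/allP sS ->]]] l|wS]; last first.
  exists (msupp w : seq K), (fun l => w@_l); split; first by apply/allP.
  rewrite {1}[w]monalgE; apply: eq_bigr => l _.
  by apply/malgP => l'; rewrite mcoeffZ !mcoeffU mulrnAr mulr1.
rewrite -mcoeff_neq0 raddf_sum /= big_seq.
apply: contraNT => nSl; rewrite big1 // => l' ls.
rewrite mcoeffZ mcoeffU; case: eqP => [ll'|_]; last by rewrite mulr0.
by rewrite -ll' sS in nSl.
Qed.

Lemma span_of_linear S a v w :
  span_of S v -> span_of S w -> span_of S (a *: v + w).
Proof.
rewrite !span_ofP => vS wS l; rewrite -mcoeff_neq0 mcoeffD mcoeffZ => nz.
have [vl|vl] := boolP (l \in msupp v); first exact: vS.
apply: wS; rewrite -mcoeff_neq0; apply: contraNneq nz => ->.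
by rewrite (mcoeff_outdom vl) mulr0 addr0.
Qed.

Lemma span_of0 S : span_of S (0 : {malg F[K]}).
Proof. by rewrite span_ofP => l; rewrite msupp0. Qed.

Lemma span_ofZ S a v : span_of S v -> span_of S (a *: v).
Proof. by move=> vS; rewrite -[_ *: _]addr0; apply/span_of_linear/span_of0. Qed.

Lemma span_of_basis S l : S l -> span_of S (<< l >> : {malg F[K]}).
Proof.
move=> Sl; exists [:: l], (fun=> 1); split; first by rewrite /= Sl.
by rewrite big_seq1 scale1r.
Qed.

Lemma span_of_sum S (I : Type) (s : seq I) (P : pred I)
    (G : I -> {malg F[K]}) :
  (forall i, P i -> span_of S (G i)) -> span_of S (\sum_(i <- s | P i) G i).
Proof.
move=> GS; elim/big_ind: _ => //; first exact: span_of0.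
by move=> v w vS wS; rewrite -[v]scale1r; apply: span_of_linear.
Qed.

Lemma linear_span_eq S (V : lmodType F) (f g : {malg F[K]} -> V) :
    linear f -> linear g -> (forall l, S l -> f << l >> = g << l >>) ->
  forall v, span_of S v -> f v = g v.
Proof.
move=> lf lg fg _ [s [c [sS ->]]].
have f0 (h : {malg F[K]} -> V) : linear h -> h 0 = 0.
  by move=> lh; have := lh (-1) 0 0; rewrite scaler0 addr0 scaleN1r addNr.
elim: s sS => [|l s IHs] /=; first by rewrite big_nil !f0.
by case/andP=> /fg fgl /IHs IH; rewrite big_cons lf lg fgl IH.
Qed.

Lemma linear_span_stable S (f : {linear {malg F[K]} -> {malg F[K]}}) :
    (forall l, S l -> span_of S (f << l >>)) ->
  forall v, span_of S v -> span_of S (f v).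
Proof.
move=> fS _ [s [c [/allP sS ->]]]; rewrite linear_sum /= big_seq.
by apply: span_of_sum => l /sS Sl; rewrite linearZ; apply/span_ofZ/fS.
Qed.

End FreeModuleTheory.

(** * Cancellation of vanishing factors *)

Section FormalFractions.
Variables (F : fieldType) (q1 q3 : F).
Implicit Types (x : qfrac) (p : int * int).

Local Notation qfactor := (qfactor q1 q3).
Local Notation qvanish := (qvanish q1 q3).

Lemma count_seqD (T : eqType) (s t : seq T) (p : T) :
  count_mem p (seqD s t) = (count_mem p s - count_mem p t)%N.
Proof.
elim: t s => [|y t IHt] s /=; first by rewrite subn0.
rewrite IHt count_rem /= -subnDA; case: (y =P p) => [->|_] /=;
  last by rewrite andbF.
by rewrite andbT; case: (boolP (p \in s)) => [//|/count_memPn->]; rewrite !sub0n.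
Qed.

Lemma count_filter_mem (T : eqType) (a : pred T) (s : seq T) (p : T) :
  count_mem p (filter a s) = if a p then count_mem p s else 0%N.
Proof.
rewrite count_filter; case: ifP => ap.
  by apply: eq_count => y /=; case: eqP => // ->; rewrite ap.
by rewrite -(count_pred0 s); apply: eq_count => y /=; case: eqP => // ->.
Qed.

Lemma mem_seqD_filter (T : eqType) (a : pred T) (s t : seq T) (p : T) :
  (p \in seqD s (filter a t)) =
  ((if a p then count_mem p t else 0) < count_mem p s)%N.
Proof. by rewrite -has_pred1 has_count count_seqD count_filter_mem subn_gt0. Qed.

Lemma prod_qfactor_neq0 (s : seq (int * int)) :
  reflect {in s, forall p, ~~ qvanish p} (\prod_(p <- s) qfactor p != 0).
Proof. by rewrite prodf_seq_neq0; apply: (iffP allP). Qed.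

(** After the cancellation a vanishing factor survives in the denominator exactly
    when it was there with greater multiplicity than in the numerator. *)
Lemma qregularP x :
  qregular q1 q3 x <->
  forall p, qvanish p -> (count_mem p (qden x) <= count_mem p (qnum x))%N.
Proof.
rewrite /qregular; split=> [/prod_qfactor_neq0 reg p vp|reg].
  rewrite leqNgt; apply: contraL (vp) => lt_p; apply: reg.
  by rewrite /= mem_seqD_filter vp.
apply/prod_qfactor_neq0 => p; rewrite /= mem_seqD_filter.
by case: ifP => [/reg le_p|//]; rewrite ltnNge le_p.
Qed.

Lemma qvalue_eq0 x p :
  qvanish p -> (count_mem p (qden x) < count_mem p (qnum x))%N ->
  qvalue q1 q3 x = 0.
Proof.
move=> vp lt_p; rewrite /qvalue; apply/eqP; rewrite mulf_eq0; apply/orP; left.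
apply: contraTT (vp) => /prod_qfactor_neq0; apply.
by rewrite /= mem_seqD_filter vp.
Qed.

Lemma qvalue_no_pole x :
  {in qden x, forall p, ~~ qvanish p} ->
  qvalue q1 q3 x =
  (\prod_(p <- qnum x) qfactor p) / (\prod_(p <- qden x) qfactor p).
Proof.
move=> nov; rewrite /qvalue; congr (_ / _); apply: perm_big;
  apply/allP => p _ /=; rewrite count_seqD count_filter_mem;
  case: ifP => vp; rewrite ?subn0 //; apply/eqP; last first.
- suff ->: count_mem p (qden x) = 0%N by [].
  by apply/count_memPn; apply: contraL vp => /nov.
- suff ->: count_mem p (qden x) = 0%N by rewrite subn0.
  by apply/count_memPn; apply: contraL vp => /nov.
Qed.

Lemma perm_qvalue x y :
  perm_eq (qnum x) (qnum y) -> perm_eq (qden x) (qden y) ->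
  qvalue q1 q3 x = qvalue q1 q3 y /\ (qregular q1 q3 x <-> qregular q1 q3 y).
Proof.
move=> /permP pnum /permP pden; split; last first.
  by rewrite !qregularP; split=> reg p /reg; rewrite pnum pden.
by congr (_ / _); apply: perm_big; apply/allP => p _ /=;
  rewrite !count_seqD !count_filter_mem !pnum !pden.
Qed.

End FormalFractions.

(** * Rational functions of the structure constants *)

Section StructureFunctions.
Variables (F : fieldType) (q1 q2 q3 : F).
Hypotheses (q1_neq0 : q1 != 0) (q3_neq0 : q3 != 0) (q123 : q1 * q2 * q3 = 1).

Definition gq (a b : F) : F := (a - q1 * b) * (a - q2 * b) * (a - q3 * b).

(** The factor contributed by a column at position [y] when a box is added to a
    later column at position [t * y]; note that [q1 * q3] is the inverse of
    [q2].  Division by zero gives zero, so [omega] is zero at its poles. *)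
Definition omega (t : F) : F :=
  ((1 - q3^-1 * t) * (1 - q1 * q3 * t)) / ((1 - t) * (1 - q1 * t)).

(** Common factor of the two values of [omega] that occur when boxes are added at
    [y] and [z] in either order; dividing by it turns paths into products of
    values of [gq]. *)
Definition omega_common (y z : F) : F :=
  q1 / ((y - z) * (q1 * y - z) * (y - q1 * z)).

(** The weight of a path whose boxes are at [a], [b], [c], in the order of their
    addition, in the nested commutator of [e_0], [e_1] and [e_(-1)]. *)
Definition serre_weight (a b c : F) : F := b / a - a / b - c / b + b / c.

Lemma q2E : q2 = (q1 * q3)^-1.
Proof.
by apply: (mulIf (mulf_neq0 q1_neq0 q3_neq0)); rewrite mulVf ?mulf_neq0 // -q123; ring.
Qed.

Lemma gpoly_gq a b :
  \sum_(s < 4) (gpoly q1 q2 q3)`_s * (a ^+ s * b ^+ (3 - s)) = gq a b.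
Proof.
have ->: gpoly q1 q2 q3 = 'X^3 - (q1 + q2 + q3) *: 'X^2 +
    (q1 * q2 + q1 * q3 + q2 * q3) *: 'X - (q1 * q2 * q3)%:P.
  rewrite /gpoly -!mul_polyC !(polyCD, polyCM); ring.
by rewrite !big_ord_recl big_ord0 /= !coefE /= /gq; ring.
Qed.

Lemma omega_small_first (y z : F) : y != 0 -> y != z -> q1 * y != z ->
  y != q1 * z -> omega (z / (q1 * y)) = omega_common y z * gq y z.
Proof.
rewrite -[y == z]subr_eq0 -[_ == z]subr_eq0 -[_ == q1 * z]subr_eq0.
move=> y0 yz qyz yqz; rewrite /omega /omega_common /gq q2E; field.
by rewrite q1_neq0 q3_neq0 y0 yz qyz yqz.
Qed.

Lemma omega_big_first (y z : F) : y != 0 -> y != z -> q1 * y != z ->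
  y != q1 * z -> omega (z / y) = - (omega_common y z * gq z y).
Proof.
rewrite -[y == z]subr_eq0 -[_ == z]subr_eq0 -[_ == q1 * z]subr_eq0.
move=> y0 yz qyz yqz; rewrite /omega /omega_common /gq q2E; field.
by rewrite q1_neq0 q3_neq0 y0 yz qyz yqz.
Qed.

Lemma omega_exchange (y z : F) : y != 0 -> y != z -> q1 * y != z ->
  y != q1 * z -> gq z y * omega (z / (q1 * y)) = - (gq y z * omega (z / y)).
Proof.
move=> *; rewrite omega_small_first ?omega_big_first //; ring.
Qed.

(** Clearing the denominators of the weights leaves a polynomial identity, valid
    for every cubic form [a^3 - s1 a^2 b + s2 a b^2 - b^3]; the last coefficient
    is where [q1 * q2 * q3 = 1] enters. *)
Lemma serre_alternating (x y z : F) : x != 0 -> y != 0 -> z != 0 ->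
    serre_weight x y z * (gq x y * gq x z * gq y z)
  - serre_weight x z y * (gq x z * gq x y * gq z y)
  - serre_weight y x z * (gq y x * gq y z * gq x z)
  + serre_weight y z x * (gq y z * gq y x * gq z x)
  + serre_weight z x y * (gq z x * gq z y * gq x y)
  - serre_weight z y x * (gq z y * gq z x * gq y x) = 0.
Proof.
move=> x0 y0 z0; rewrite /serre_weight.
have gE a b : gq a b = a ^+ 3 - (q1 + q2 + q3) * a ^+ 2 * b +
    (q1 * q2 + q1 * q3 + q2 * q3) * a * b ^+ 2 - b ^+ 3.
  rewrite -[in b ^+ 3](mul1r (b ^+ 3)) -q123 /gq; ring.
rewrite !gE; move: (q1 + q2 + q3) (q1 * q2 + _ + _) => s1 s2.
field; by rewrite x0 y0 z0.
Qed.

(** The degenerate case of two boxes in one column, at [x] and [q1 * x]: the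
    orders that add the upper box first do not occur.  The other column comes
    after the doubled one here, and before it in the next lemma. *)
Lemma serre_double (x z : F) : x != 0 -> z != 0 -> x != z -> q1 * x != z ->
    q1 * (q1 * x) != z -> x != q1 * z ->
    serre_weight x (q1 * x) z * omega (z / (q1 * (q1 * x)))
  + serre_weight x z (q1 * x) * omega (z / (q1 * x))
  + serre_weight z x (q1 * x) * omega (z / x) = 0.
Proof.
rewrite -[x == z]subr_eq0 -[q1 * x == z]subr_eq0.
rewrite -[q1 * (q1 * x) == z]subr_eq0 -[_ == q1 * z]subr_eq0 => x0 z0 h1 h2 h3 h4.
rewrite /omega /serre_weight; field.
by rewrite ?q1_neq0 ?q3_neq0 ?x0 ?z0 ?h1 ?h2 ?h3 ?h4 /=.
Qed.

Lemma serre_double_big (x y : F) : x != 0 -> y != 0 -> x != y -> q1 * x != y ->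
    x != q1 * y -> x != q1 * (q1 * y) ->
    serre_weight y (q1 * y) x * omega (q1 * y / x)
  + serre_weight y x (q1 * y) * omega (y / x)
  + serre_weight x y (q1 * y) * omega (y / (q1 * x)) = 0.
Proof.
rewrite -[x == y]subr_eq0 -[q1 * x == y]subr_eq0 -[x == q1 * y]subr_eq0.
rewrite -[_ == q1 * (q1 * y)]subr_eq0 => x0 y0 h1 h2 h3 h4.
rewrite /omega /serre_weight; field.
by rewrite ?q1_neq0 ?q3_neq0 ?x0 ?y0 ?h1 ?h2 ?h3 ?h4 /=.
Qed.

End StructureFunctions.

(** * Admissible partitions and resonances *)

Section Admissible.
Variables (N k r : nat).
Hypotheses (k_ge1 : (1 <= k)%N) (r_ge2 : (2 <= r)%N).

Local Notation weight := {ffun 'I_N -> int}.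
Local Notation adm := (@admissible N k r).
Implicit Types (l m : weight) (i j : 'I_N).

Lemma admissibleP l :
  reflect ((forall i j, (i <= j)%N -> l j <= l i) /\
           (forall i j, j = (i + k)%N :> nat -> r%:Z <= l i - l j))
          (adm l).
Proof.
apply: (iffP andP) => -[lp lr]; split.
- by move=> i j; apply/implyP; have /forallP/(_ i)/forallP/(_ j) := lp.
- by move=> i j /eqP; apply/implyP; have /forallP/(_ i)/forallP/(_ j) := lr.
- by apply/forallP => i; apply/forallP => j; apply/implyP => /lp.
- by apply/forallP => i; apply/forallP => j; apply/implyP => /eqP/lr.
Qed.

Lemma adm_le l i j : adm l -> (i <= j)%N -> l j <= l i.
Proof. by case/admissibleP=> + _; apply. Qed.

Lemma adm_gap l i j : adm l -> j = (i + k)%N :> nat -> r%:Z <= l i - l j.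
Proof. by case/admissibleP=> _; apply. Qed.

Lemma adm_chain l i j (a : nat) :
  adm l -> (j + k * a <= i)%N -> (r * a)%N%:Z <= l j - l i.
Proof.
move=> al; elim: a j => [|a IHa] j le_ji.
  by rewrite muln0 subr_ge0; apply: adm_le => //; lia.
have lt_jN : (j + k < N)%N by apply: leq_ltn_trans (ltn_ord i); nia.
have := @adm_gap l j (Ordinal lt_jN) al erefl.
have := IHa (Ordinal lt_jN); rewrite /= mulnS PoszD.
have -> : (j + k + k * a <= i)%N by nia.
move/(_ isT); lia.
Qed.

Definition box (l : weight) i : weight := l + wunit i.

Lemma boxE l i j : box l i j = l j + (i == j)%:Z.
Proof. by rewrite !ffunE. Qed.

Lemma box_neq l i j : i != j -> box l i j = l j.
Proof. by move=> ij; rewrite boxE (negPf ij) addr0. Qed.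

Lemma box_eq l i : box l i i = l i + 1.
Proof. by rewrite boxE eqxx. Qed.

Lemma boxC l i j : box (box l i) j = box (box l j) i.
Proof. by rewrite /box addrAC. Qed.

(** A box added to an admissible partition can only violate the condition that
    compares column [i] with its left neighbour, or with the column [k] steps to
    the left. *)
Lemma not_adm_box l i : adm l -> ~~ adm (box l i) ->
  (exists2 j : 'I_N, i = j.+1 :> nat & l j = l i) \/
  (exists2 j : 'I_N, i = (j + k)%N :> nat & l j = l i + r%:Z).
Proof.
move=> al; rewrite negb_and => /orP[] /forallPn[a] /forallPn[b];
  rewrite negb_imply => /andP[ab]; rewrite -ltNge !boxE.
- case: (i =P b) => [ib|_]; last first.
    move=> lt_ab; have := adm_le al ab; lia.
  case: (i =P a) => [<-|ia]; first by rewrite -ib ltxx.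
  rewrite addr0 -ib => lt_ai; left.
  have ai : (a < i)%N.
    by move: ab; rewrite -ib leq_eqVlt => /orP[/eqP/val_inj/esym|].
  have lt_N : (i.-1 < N)%N by have := ltn_ord i; lia.
  exists (Ordinal lt_N) => /=; first lia.
  have := @adm_le l (Ordinal lt_N) i al; have := @adm_le l a (Ordinal lt_N) al.
  move=> /(_ ltac:(rewrite /=; lia)) + /(_ ltac:(rewrite /=; lia)); lia.
- have {}ab := eqP ab; have gap := adm_gap al ab.
  case: (i =P b) => [ib|_]; last by case: (i =P a); lia.
  case: (i =P a) => [ia|_]; first by move: ab; rewrite -ib -ia; lia.
  move=> lt_r; right; exists a; first by rewrite ib.
  by rewrite ib; move: gap lt_r; lia.
Qed.

(** Two columns at distance [k + 1] whose heights differ by exactly [r]: the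
    configuration at which the matrix coefficients have a pole.  Admissibility
    squeezes the neighbours of the two columns to the same two heights. *)
Definition tight l j i : Prop :=
  i = (j + k.+1)%N :> nat /\ l j = l i + r%:Z.

Lemma tight_next l i j j1 : adm l -> tight l j i -> j1 = j.+1 :> nat ->
  l j1 = l j.
Proof.
move=> al [ij lji] j1E; have := @adm_le l j j1 al ltac:(lia).
have := @adm_gap l j1 i al ltac:(lia); lia.
Qed.

Lemma tight_prev l i j i1 : adm l -> tight l j i -> i = i1.+1 :> nat ->
  l i1 = l i.
Proof.
move=> al [ij lji] i1E; have := @adm_le l i1 i al ltac:(lia).
have := @adm_gap l j i1 al ltac:(lia); lia.
Qed.

Lemma tight_k_gt1 l i j : adm l -> tight l j i -> (1 < k)%N.
Proof.
move=> al t; have [ij _] := t; rewrite ltn_neqAle k_ge1 andbT eq_sym.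
apply/eqP => k1; have lt_N : (j.+1 < N)%N by have := ltn_ord i; lia.
have := @adm_gap l (Ordinal lt_N) i al ltac:(rewrite /=; lia).
rewrite (@tight_prev l i j (Ordinal lt_N)) //=; lia.
Qed.

(** Adding a box to column [i] is only admissible once columns [i - 1] and [i - k]
    have grown; the latter is [j + 1], as high as column [j], which must then
    grow as well.  These four columns are distinct, because [k > 1]. *)
Lemma tight_four_boxes l m i j : adm l -> adm m -> (forall a, l a <= m a) ->
    tight l j i -> l i < m i ->
  forall s : seq 'I_N, (forall a, l a < m a -> a \in s) -> (3 < size s)%N.
Proof.
move=> al am lm t lt_i s sP; have [ij lji] := t; have k2 := tight_k_gt1 al t.
have lt_N1 : (j.+1 < N)%N by have := ltn_ord i; lia.
have lt_N2 : (i.-1 < N)%N by have := ltn_ord i; lia.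
pose j1 := Ordinal lt_N1; pose i1 := Ordinal lt_N2.
have lj1 : l j1 = l j by apply: tight_next t _.
have li1 : l i1 = l i by apply: tight_prev t _ => //=; lia.
have mi1 := @adm_le m i1 i am ltac:(rewrite /=; lia).
have mj1 := @adm_gap m j1 i am ltac:(rewrite /=; lia).
have mj := @adm_le m j j1 am ltac:(rewrite /=; lia).
pose t4 := [:: j; j1; i1; i].
have : {subset t4 <= s}.
  move=> a; rewrite !inE => /or4P[] /eqP->; apply: sP => //; lia.
apply: uniq_leq_size; rewrite /= !inE -!val_eqE /=; lia.
Qed.

End Admissible.

(** * Matrix coefficients of the raising operators *)

Section Coefficients.
Variables (F : fieldType) (N k r : nat) (q1 q3 u : F).
Hypotheses (k_ge1 : (1 <= k)%N) (r_ge2 : (2 <= r)%N).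
Hypotheses (u_neq0 : u != 0) (q1_neq0 : q1 != 0) (q3_neq0 : q3 != 0).
Hypothesis only_resonance : forall n m : int,
  q1 ^ n * q3 ^ m = 1 <->
  exists a : int, n = (1 - r%:Z) * a /\ m = (k%:Z + 1) * a.

Local Notation weight := {ffun 'I_N -> int}.
Local Notation adm := (@admissible N k r).
Local Notation x := (@psi_c N F q1 q3 u).
Local Notation omega := (omega q1 q3).
Implicit Types (l m : weight) (i j : 'I_N).

Lemma x_neq0 l i : x l i != 0.
Proof. by rewrite /psi_c !mulf_neq0 ?expfz_neq0. Qed.

Lemma x_ratio l i j :
  x l i / x l j = q1 ^ (l i - l j) * q3 ^ (i%:Z - j%:Z).
Proof.
rewrite /psi_c !expfzDr // -!invr_expz; field.
by rewrite u_neq0 !expfz_neq0.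
Qed.

Lemma x_box_eq l i : x (box l i) i = q1 * x l i.
Proof. by rewrite /psi_c box_eq expfzDr // expr1z; ring. Qed.

Lemma x_box_neq l i j : i != j -> x (box l i) j = x l j.
Proof. by move=> ij; rewrite /psi_c box_neq. Qed.

Lemma x_box l i j : x (box l i) j = (if i == j then q1 else 1) * x l j.
Proof.
by case: eqP => [->|/eqP ij]; rewrite ?x_box_eq // x_box_neq // mul1r.
Qed.

Lemma qfactor_ratio l i j (a b : int) :
  qfactor q1 q3 (l i - l j + a, i%:Z - j%:Z + b) =
  1 - q1 ^ a * q3 ^ b * (x l i / x l j).
Proof. by rewrite /qfactor x_ratio /= !expfzDr //; ring. Qed.

(** At horizontal distance [(k + 1) * a] a resonance requires the height
    difference [(r - 1) * a + c], whereas admissibility gives at least [r * a].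
    Hence only the shifts [c >= a >= 1] can be resonant. *)
Lemma resonant_ratio l i j (c : int) :
    adm l -> (j < i)%N -> q1 ^ c * x l i = x l j ->
  exists a : nat, [/\ (0 < a)%N, a%:Z <= c, i = (j + k.+1 * a)%N :> nat
    & l j - l i = (r%:Z - 1) * a%:Z + c].
Proof.
move=> al ji e.
have : q1 ^ (l i - l j + c) * q3 ^ (i%:Z - j%:Z) = 1.
  by rewrite expfzDr // mulrAC -x_ratio mulrAC [_ * _ ^ c]mulrC e divff ?x_neq0.
case/only_resonance => -[a|a] [ea eb]; last by nia.
have a0 : (0 < a)%N by nia.
have gap : (r * a)%N%:Z <= l j - l i by apply: (adm_chain k_ge1 r_ge2 al) => //; nia.
by exists a; split=> //; nia.
Qed.

Lemma x_neq l i j : adm l -> (j < i)%N -> x l j != x l i.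
Proof.
move=> al ji; apply/eqP => e.
have [] := @resonant_ratio l i j 0 al ji; first by rewrite expr0z mul1r.
by move=> a []; lia.
Qed.

Lemma x_inj l : adm l -> injective (x l).
Proof.
move=> al i j e; apply/val_inj; case: (ltngtP i j) => // ij.
  by have := x_neq al ij; rewrite e eqxx.
by have := x_neq al ij; rewrite e eqxx.
Qed.

Lemma x_neq_shift l i j : adm l -> (j < i)%N -> q1 * x l j != x l i.
Proof.
move=> al ji; apply/eqP => e.
have [] := @resonant_ratio l i j (-1) al ji; first by rewrite -e exprN1 mulKf.
by move=> a []; lia.
Qed.

Lemma x_neq_shift2 l i j : adm l -> (j < i)%N -> q1 * (q1 * x l j) != x l i.
Proof.
move=> al ji; apply/eqP => e.
have [] := @resonant_ratio l i j (-2) al ji; last by move=> a []; lia.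
by rewrite -e mulrA -expr2 -[q1 ^ _]/((q1 ^+ 2)^-1) mulKf ?expf_neq0.
Qed.

Lemma x_tight l i j : adm l -> (j < i)%N ->
  q1 * x l i = x l j <-> tight k r l j i.
Proof.
move=> al ji; split=> [e|[ij lji]].
  have [] := @resonant_ratio l i j 1 al ji; first by rewrite expr1z.
  move=> a [a0 a1 + +]; have -> : a = 1%N by lia.
  by rewrite muln1 mulr1 => ij ?; split; lia.
apply: (mulIf (invr_neq0 (x_neq0 l j))); rewrite divff ?x_neq0 //.
rewrite -mulrA x_ratio mulrA -{1}(expr1z q1) -expfzDr //.
apply/only_resonance; exists 1.
by rewrite lji ij; lia.
Qed.

Definition e_coef l i : F := \prod_(j < N | (j < i)%N) omega (x l i / x l j).

Lemma prod_pairs l i (f : weight -> 'I_N -> 'I_N -> seq (int * int)) :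
  \prod_(p <- flatten [seq f l i j | j <- enum 'I_N & (j < i)%N])
     qfactor q1 q3 p =
  \prod_(j < N | (j < i)%N) \prod_(p <- f l i j) qfactor q1 q3 p.
Proof. by rewrite big_flatten big_map big_filter big_enum_cond. Qed.

Lemma e_frac_ratio l i :
  (\prod_(p <- qnum (e_frac l i)) qfactor q1 q3 p) /
  (\prod_(p <- qden (e_frac l i)) qfactor q1 q3 p) = e_coef l i.
Proof.
rewrite /= !prod_pairs -prodf_div; apply: eq_bigr => j _.
rewrite !big_cons !big_nil !mulr1 /omega.
have qf := qfactor_ratio l i j.
have := qf 0 (-1); have := qf 1 1; have := qf 0 0; have := qf 1 0.
by rewrite !addr0 !expr0z !expr1z exprN1 !mul1r !mulr1 => -> -> -> ->.
Qed.

Lemma e_den_vanish l i p : adm l -> p \in qden (e_frac l i) ->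
  qvanish q1 q3 p -> p = (1 - r%:Z, k%:Z + 1) /\ exists j, tight k r l j i.
Proof.
move=> al /flatten_mapP[j]; rewrite mem_filter => /andP[ji _].
rewrite !inE /qvanish => /orP[] /eqP->.
  have := qfactor_ratio l i j 0 0; rewrite !addr0 !expr0z !mul1r => ->.
  rewrite subr_eq0 eq_sym => /eqP/(canRL (mulfVK (x_neq0 l j))).
  by rewrite mul1r => e; have := x_neq al ji; rewrite e eqxx.
have := qfactor_ratio l i j 1 0; rewrite addr0 expr0z expr1z mulr1 mulrA => ->.
rewrite subr_eq0 eq_sym => /eqP/(canRL (mulfVK (x_neq0 l j))); rewrite mul1r.
move/(x_tight al ji) => t; split; last by exists j.
by case: t => ij lji; congr (_, _); lia.
Qed.

Lemma e_num_tight l i j : adm l -> tight k r l j i ->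
  (1 - r%:Z, k%:Z + 1) \in qnum (e_frac l i).
Proof.
move=> al t; have [ij lji] := t; apply/flatten_mapP.
have lt_N : (j.+1 < N)%N by have := ltn_ord i; lia.
exists (Ordinal lt_N); first by rewrite mem_filter mem_enum /= andbT; lia.
rewrite !inE /=; apply/orP; right; apply/eqP.
have -> := @tight_next N k r k_ge1 r_ge2 l i j (Ordinal lt_N) al t erefl.
by congr (_, _); lia.
Qed.

(** Only the column at distance [k + 1] can contribute the vanishing factor. *)
Lemma e_den_simple l i :
  (count_mem (1 - r%:Z, k%:Z + 1)%R (qden (e_frac l i)) <= 1)%N.
Proof.
rewrite /= count_flatten -map_comp sumnE big_map.
set s := [seq _ <- _ | _]; have us : uniq s by rewrite filter_uniq ?enum_uniq.
pose at_dist (j : 'I_N) : bool := (i == j + k.+1 :> nat)%N.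
apply: (@leq_trans (\sum_(j <- s) at_dist j)).
  apply: leq_sum => j _ /=; rewrite /at_dist.
  case: eqP => [[e1 e2]|_]; case: eqP => [[e3 e4]|_]; rewrite ?addn0 //; lia.
have <- : count at_dist s = (\sum_(j <- s) (at_dist j : nat))%N.
  by rewrite -sumn_count sumnE big_map.
have [j0 j0P|no_j] := pickP at_dist.
  apply: (@leq_trans (count_mem j0 s)); last first.
    by rewrite count_uniq_mem //; case: (_ \in _).
  apply: sub_count => j /=; move: j0P; rewrite /at_dist => /eqP e0 /eqP e1.
  by apply/eqP/val_inj/eqP; rewrite -(eqn_add2r k.+1) -e0 -e1.
by rewrite (@eq_count _ _ pred0) ?count_pred0 // => j; rewrite no_j.
Qed.

(** At a tight pair the numerator has one vanishing factor more than the
    denominator, because the column just before [i] has the height of [i]; the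
    cancelled coefficient is then zero, and so is the quotient of the two
    uncancelled products, division by zero being zero. *)
Lemma e_fracP l i : adm l ->
  qregular q1 q3 (e_frac l i) /\ qvalue q1 q3 (e_frac l i) = e_coef l i.
Proof.
move=> al; have den1 := e_den_simple l i.
set p0 := (1 - r%:Z, k%:Z + 1) in den1 *.
split.
  apply/qregularP => p vp.
  have [pd|/count_memPn-> //] := boolP (p \in qden (e_frac l i)).
  have [-> [j t]] := e_den_vanish al pd vp.
  apply: leq_trans den1 _; rewrite -has_count has_pred1; exact: e_num_tight t.
have [/hasP[p pd vp]|/hasPn nov] := boolP (has (qvanish q1 q3) (qden (e_frac l i))).
  have [pE [j t]] := e_den_vanish al pd vp; have [ij lji] := t.
  have v00 : qvanish q1 q3 (0, 0) by rewrite /qvanish /qfactor /= mulr1 subrr.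
  rewrite (qvalue_eq0 v00); last first.
    suff [/count_memPn-> in_num] : (0, 0) \notin qden (e_frac l i) /\
        (0, 0) \in qnum (e_frac l i) by rewrite -has_count has_pred1.
    split; first by apply/negP => /(e_den_vanish al)/(_ v00)[[]]; lia.
    have lt_N : (i.-1 < N)%N by have := ltn_ord i; lia.
    apply/flatten_mapP; exists (Ordinal lt_N).
      by rewrite mem_filter mem_enum /= andbT; lia.
    have li1 : l (Ordinal lt_N) = l i.
      by apply: (tight_prev k_ge1 r_ge2 al t) => /=; lia.
    by rewrite inE li1 subrr; apply/orP; left; apply/eqP; congr (_, _) => /=; lia.
  rewrite -e_frac_ratio.
  set D := \prod_(p <- qden _) _; have [->|] := eqVneq D 0.
    by rewrite invr0 mulr0.
  by move/prod_qfactor_neq0/(_ p pd); rewrite vp.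
by rewrite -e_frac_ratio qvalue_no_pole.
Qed.

End Coefficients.

(** * Exchange and Serre identities for the coefficients *)

Section CoefficientRelations.
Variables (F : fieldType) (N k r : nat) (q1 q2 q3 u : F).
Hypotheses (k_ge1 : (1 <= k)%N) (r_ge2 : (2 <= r)%N).
Hypotheses (u_neq0 : u != 0) (q1_neq0 : q1 != 0) (q3_neq0 : q3 != 0).
Hypothesis q123 : q1 * q2 * q3 = 1.
Hypothesis only_resonance : forall n m : int,
  q1 ^ n * q3 ^ m = 1 <->
  exists a : int, n = (1 - r%:Z) * a /\ m = (k%:Z + 1) * a.

Local Notation weight := {ffun 'I_N -> int}.
Local Notation adm := (@admissible N k r).
Local Notation x := (@psi_c N F q1 q3 u).
Local Notation omega := (omega q1 q3).
Local Notation gq := (gq q1 q2 q3).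
Local Notation E := (e_coef q1 q3 u).
Local Notation C l i := (qvalue q1 q3 (e_frac l i)).
Implicit Types (l m : weight) (i j a b c : 'I_N).

Let xn0 := @x_neq0 F N q1 q3 u u_neq0 q1_neq0 q3_neq0.
Let xb := @x_box F N q1 q3 u q1_neq0.
Let x_neq :=
  @x_neq F N k r q1 q3 u k_ge1 r_ge2 u_neq0 q1_neq0 q3_neq0 only_resonance.
Let x_neq_shift :=
  @x_neq_shift F N k r q1 q3 u k_ge1 r_ge2 u_neq0 q1_neq0 q3_neq0 only_resonance.
Let x_neq_shift2 :=
  @x_neq_shift2 F N k r q1 q3 u k_ge1 r_ge2 u_neq0 q1_neq0 q3_neq0 only_resonance.

Lemma e_fracE l i : adm l -> C l i = E l i.
Proof.
move=> al; have [_ //] := e_fracP k_ge1 r_ge2 u_neq0 q1_neq0 q3_neq0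
  only_resonance i al.
Qed.

Lemma x_eq l m i : l i = m i -> x l i = x m i.
Proof. by rewrite /psi_c => ->. Qed.

Lemma e_coef_not_adm l i : adm l -> ~~ adm (box l i) -> E l i = 0.
Proof.
move=> al /(not_adm_box k_ge1 r_ge2 al)[] [j ij lji]; apply/eqP;
  apply/prodf_eq0; exists j; rewrite ?ij ?ltnS //; try lia;
  rewrite /omega !mulf_eq0 /= x_ratio // lji.
- suff -> : 1 - q3^-1 * (q1 ^ (l i - l i) * q3 ^ (i%:Z - j%:Z)) = 0.
    by rewrite eqxx.
  have -> : i%:Z - j%:Z = 1 by lia.
  by rewrite subrr expr0z mul1r expr1z mulVf ?subrr.
- suff -> : 1 - q1 * q3 * (q1 ^ (l i - (l i + r%:Z)) * q3 ^ (i%:Z - j%:Z)) = 0.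
    by rewrite eqxx orbT.
  have -> : q1 * q3 * (q1 ^ (l i - (l i + r%:Z)) * q3 ^ (i%:Z - j%:Z)) =
      q1 ^ (1 - r%:Z) * q3 ^ (k%:Z + 1).
    rewrite mulrACA -{1}(expr1z q1) -{1}(expr1z q3) -!expfzDr //.
    by congr (_ ^ _ * _ ^ _); lia.
  rewrite (_ : _ * _ = 1) ?subrr //; apply/only_resonance; exists 1; lia.
Qed.

(** A path through a weight that is not admissible has coefficient zero at
    the step that reaches it, so the closed formula can be used at every step. *)
Lemma e_path2 l a b : adm l -> C l a * C (box l a) b = E l a * E (box l a) b.
Proof.
move=> al; rewrite (e_fracE a al).
have [aal|/(e_coef_not_adm al)->] := boolP (adm (box l a)).
  by rewrite e_fracE.
by rewrite !mul0r.
Qed.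

Lemma e_path3 l a b c : adm l ->
  C l a * C (box l a) b * C (box (box l a) b) c =
  E l a * E (box l a) b * E (box (box l a) b) c.
Proof.
move=> al; rewrite (e_fracE a al).
have [aal|/(e_coef_not_adm al)->] := boolP (adm (box l a)).
  by rewrite -mulrA (e_path2 b c aal) mulrA.
by rewrite !mul0r.
Qed.

Lemma e_path2_eq0 l a b : adm l -> ~~ adm (box (box l a) b) ->
  C l a * C (box l a) b = 0.
Proof.
move=> al nab; rewrite e_path2 //.
have [aal|/(e_coef_not_adm al)->] := boolP (adm (box l a)).
  by rewrite (e_coef_not_adm aal nab) mulr0.
by rewrite mul0r.
Qed.

Lemma e_path3_eq0 l a b c : adm l -> ~~ adm (box (box (box l a) b) c) ->
  C l a * C (box l a) b * C (box (box l a) b) c = 0.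
Proof.
move=> al nabc.
have [aal|/(e_coef_not_adm al) E0] := boolP (adm (box l a)).
  by rewrite -mulrA (e_path2_eq0 aal nabc) mulr0.
by rewrite e_path3 // E0 !mul0r.
Qed.

Lemma e_coef_ext l m i :
  (forall j, (j <= i)%N -> m j = l j) -> E m i = E l i.
Proof.
move=> ml; apply: eq_bigr => j ji.
by rewrite (@x_eq m l i) ?(@x_eq m l j) ?ml // ltnW.
Qed.

Lemma boxNE l i j : j != i -> box l i j = l j.
Proof. by rewrite eq_sym => /box_neq. Qed.

(** The factors of [e_coef l i] that do not change when boxes are added to the
    columns that are left out. *)
Definition e_rest1 l i a : F :=
  \prod_(j < N | (j < i)%N && (j != a)) omega (x l i / x l j).

Definition e_rest2 l i a b : F :=
  \prod_(j < N | (j < i)%N && (j != a) && (j != b)) omega (x l i / x l j).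

Lemma e_coef_split1 l m i a : (a < i)%N ->
  (forall j, j != a -> m j = l j) ->
  E m i = omega (x l i / x m a) * e_rest1 l i a.
Proof.
move=> ai ml; have ia : i != a by rewrite -val_eqE gtn_eqF.
rewrite /e_coef (bigD1 a) //= (@x_eq m l i) ?ml //; congr (_ * _).
by apply: eq_bigr => j /andP[_ ja]; rewrite (@x_eq m l j) ?ml.
Qed.

Lemma e_coef_split2 l m i a b : (a < i)%N -> (b < i)%N -> a != b ->
  (forall j, j != a -> j != b -> m j = l j) ->
  E m i = omega (x l i / x m a) * omega (x l i / x m b) * e_rest2 l i a b.
Proof.
move=> ai bi ab ml; have ia : i != a by rewrite -val_eqE gtn_eqF.
have ib : i != b by rewrite -val_eqE gtn_eqF.
rewrite /e_coef (bigD1 a) //= (bigD1 b) ?bi 1?eq_sym //=.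
rewrite (@x_eq m l i) ?ml // mulrA; congr (_ * _).
by apply: eq_bigr => j /andP[/andP[_ ja] jb]; rewrite (@x_eq m l j) ?ml.
Qed.

Lemma not_tight_of_boxes l m i j (s : seq 'I_N) :
    adm l -> adm m -> (forall a, l a <= m a) -> l i < m i ->
    (forall a, l a < m a -> a \in s) -> (size s <= 3)%N -> (j < i)%N ->
  x l j != q1 * x l i.
Proof.
move=> al am lm mi sP s3 ji; rewrite eq_sym; apply/eqP.
move/(x_tight k_ge1 r_ge2 u_neq0 q1_neq0 q3_neq0 only_resonance al ji) => t.
by have := tight_four_boxes k_ge1 r_ge2 al am lm t mi sP; rewrite ltnNge s3.
Qed.

Lemma not_tight2 l a b i j : adm l -> adm (box (box l a) b) ->
  i \in [:: a; b] -> (j < i)%N -> x l j != q1 * x l i.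
Proof.
move=> al am iab; apply: (not_tight_of_boxes (s := [:: a; b]) al am) => //.
- by move=> c; rewrite !boxE; lia.
- by move: iab; rewrite !inE !boxE => /orP[] /eqP->; rewrite eqxx; lia.
- move=> c; rewrite !inE !boxE ![_ == c]eq_sym.
  by case: (c == a); case: (c == b); rewrite ?addr0 ?ltxx.
Qed.

Lemma not_tight3 l a b c i j : adm l -> adm (box (box (box l a) b) c) ->
  i \in [:: a; b; c] -> (j < i)%N -> x l j != q1 * x l i.
Proof.
move=> al am iab; apply: (not_tight_of_boxes (s := [:: a; b; c]) al am) => //.
- by move=> d; rewrite !boxE; lia.
- by move: iab; rewrite !inE !boxE => /or3P[] /eqP->; rewrite eqxx; lia.
- move=> d; rewrite !inE !boxE ![_ == d]eq_sym.
  by case: (d == a); case: (d == b); case: (d == c); rewrite ?addr0 ?ltxx.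
Qed.

Lemma ltn_ord_neq i j : (i < j)%N -> (i != j) * (j != i).
Proof. by move=> ij; rewrite -!val_eqE /= ltn_eqF ?gtn_eqF. Qed.

(** Only the factor of the pair [(i, j)] in the coefficient of the later column
    depends on the order of the two boxes. *)
Lemma e_exchange l i j : adm l -> i != j ->
  gq (x l i) (x l j) * (C l j * C (box l j) i) =
  - (gq (x l j) (x l i) * (C l i * C (box l i) j)).
Proof.
move=> al; wlog ji : i j / (j < i)%N => [hw ij|_].
  case: (ltngtP i j) => [ltij|ltji|/val_inj/eqP]; last by rewrite (negPf ij).
    by rewrite (hw j i) ?opprK // eq_sym.
  exact: hw.
have [am|nam] := boolP (adm (box (box l j) i)); last first.
  by rewrite !e_path2_eq0 ?mulr0 ?oppr0 // boxC.
have nji := ltn_ord_neq ji.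
have xt : x l j != q1 * x l i.
  by apply: (not_tight2 al am) => //; rewrite !inE eqxx orbT.
rewrite !e_path2 // (@e_coef_ext l (box l i) j); last first.
  by move=> c cj; rewrite box_neq // -val_eqE /= gtn_eqF // (leq_ltn_trans cj).
rewrite (@e_coef_split1 l (box l j) i j) //; last first.
  by move=> c cj; rewrite box_neq // eq_sym.
rewrite (@e_coef_split1 l l i j) // x_box_eq //.
have := omega_exchange q1_neq0 q3_neq0 q123 (xn0 l j) (x_neq al ji)
  (x_neq_shift al ji) xt.
set o1 := omega _; set o2 := omega _ => oE.
transitivity (gq (x l i) (x l j) * o1 * (E l j * e_rest1 l i j)); first by ring.
by rewrite oE; ring.
Qed.

Definition serre_path l a b c : F :=
  serre_weight (x l a) (x (box l a) b) (x (box (box l a) b) c) *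
  (C l a * C (box l a) b * C (box (box l a) b) c).

Lemma serre_path_eq0 l a b c :
  adm l -> ~~ adm (box (box (box l a) b) c) -> serre_path l a b c = 0.
Proof. by move=> al nam; rewrite /serre_path e_path3_eq0 ?mulr0. Qed.

Lemma serre_distinct l a b c :
    adm l -> adm (box (box (box l a) b) c) -> (a < b)%N -> (b < c)%N ->
  serre_path l a b c + serre_path l a c b + serre_path l b a c +
  serre_path l b c a + serre_path l c a b + serre_path l c b a = 0.
Proof.
move=> al am ab bc; have ac := ltn_trans ab bc.
have nab := ltn_ord_neq ab; have nac := ltn_ord_neq ac.
have nbc := ltn_ord_neq bc.
have xab : x l a != q1 * x l b.
  by apply: (not_tight3 al am) => //; rewrite !inE eqxx ?orbT.
have xac : x l a != q1 * x l c.
  by apply: (not_tight3 al am) => //; rewrite !inE eqxx ?orbT.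
have xbc : x l b != q1 * x l c.
  by apply: (not_tight3 al am) => //; rewrite !inE eqxx ?orbT.
have Ea m : (forall j, j != b -> j != c -> m j = l j) -> E m a = E l a.
  move=> ml; apply: e_coef_ext => j ja; apply: ml.
    by rewrite -val_eqE /= ltn_eqF // (leq_ltn_trans ja).
  by rewrite -val_eqE /= ltn_eqF // (leq_ltn_trans ja).
have Eb m : (forall j, j != a -> j != c -> m j = l j) ->
    E m b = omega (x l b / x m a) * e_rest1 l b a.
  move=> ml; pose m' := [ffun j => if j == c then l c else m j].
  rewrite -(@e_coef_ext m m' b); last first.
    move=> j jb; rewrite ffunE ifN // -val_eqE /= ltn_eqF //.
    exact: leq_ltn_trans jb bc.
  rewrite (@e_coef_split1 l m' b a) //; last first.
    by move=> j ja; rewrite ffunE; case: (j =P c) => [->//|/eqP jc]; apply: ml.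
  by rewrite (@x_eq m' m a) // ffunE (negPf nac.1).
have Ec m : (forall j, j != a -> j != b -> m j = l j) ->
    E m c = omega (x l c / x m a) * omega (x l c / x m b) * e_rest2 l c a b.
  by move=> ml; apply: e_coef_split2; rewrite ?nab.
rewrite /serre_path !e_path3 //.
rewrite !Ea ?Eb ?Ec; try by move=> j jd je; rewrite ?(boxNE, jd, je).
rewrite !xb ?eqxx !(negPf nab.1) !(negPf nab.2) !(negPf nac.1).
rewrite !(negPf nac.2) !(negPf nbc.1) !(negPf nbc.2) !mul1r.
move: xab xac xbc (xn0 l a) (xn0 l b) (xn0 l c) (x_neq al ab) (x_neq al ac)
  (x_neq al bc) (x_neq_shift al ab) (x_neq_shift al ac) (x_neq_shift al bc).
move: (x l a) (x l b) (x l c) (E l a) (e_rest1 l b a) (e_rest2 l c a b).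
move=> X Y Z A B D h1 h2 h3 X0 Y0 Z0 h4 h5 h6 h7 h8 h9.
have small := omega_small_first q1_neq0 q3_neq0 q123.
have big := omega_big_first q1_neq0 q3_neq0 q123.
rewrite (small X Y) // (small X Z) // (small Y Z) //.
rewrite (big X Y) // (big X Z) // (big Y Z) //.
have := serre_alternating q123 X0 Y0 Z0; set s := (X in X = 0) => s0.
transitivity (s * (A * B * D * (omega_common q1 X Y * omega_common q1 X Z * omega_common q1 Y Z))).
  by rewrite /s; ring.
by rewrite s0 mul0r.
Qed.

Lemma serre_repeat_first l a c : adm l -> adm (box (box (box l a) a) c) ->
  (a < c)%N ->
  serre_path l a a c + serre_path l a c a + serre_path l c a a = 0.
Proof.
move=> al am ac; have nac := ltn_ord_neq ac.
have xac : x l a != q1 * x l c.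
  by apply: (not_tight3 al am) => //; rewrite !inE eqxx ?orbT.
have Ea m : E (box m c) a = E m a.
  apply: e_coef_ext => j ja; rewrite boxNE // -val_eqE /= ltn_eqF //.
  exact: leq_ltn_trans ja ac.
have Ec m : (forall j, j != a -> m j = l j) ->
    E m c = omega (x l c / x m a) * e_rest1 l c a.
  exact: e_coef_split1.
rewrite /serre_path !e_path3 // (boxC l c a) !Ea.
rewrite !Ec; try by move=> j ja; rewrite ?(boxNE, ja).
rewrite !xb ?eqxx !(negPf nac.1) !(negPf nac.2) !mul1r.
move: xac (xn0 l a) (xn0 l c) (x_neq al ac) (x_neq_shift al ac)
  (x_neq_shift2 al ac).
move: (x l a) (x l c) (E l a) (E (box l a) a) (e_rest1 l c a).
move=> X Z A A' B h1 X0 Z0 h2 h3 h4.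
have := serre_double q1_neq0 q3_neq0 X0 Z0 h2 h3 h4 h1.
set s := (X in X = 0) => s0.
by transitivity (s * (A * A' * B)); [rewrite /s; ring | rewrite s0 mul0r].
Qed.

Lemma serre_repeat_last l a b : adm l -> adm (box (box (box l a) b) b) ->
  (a < b)%N ->
  serre_path l a b b + serre_path l b a b + serre_path l b b a = 0.
Proof.
move=> al am ab; have nab := ltn_ord_neq ab.
have xab : x l a != q1 * x l b.
  by apply: (not_tight3 al am) => //; rewrite !inE eqxx ?orbT.
have Ea m : E (box m b) a = E m a.
  apply: e_coef_ext => j ja; rewrite boxNE // -val_eqE /= ltn_eqF //.
  exact: leq_ltn_trans ja ab.
have Eb m : (forall j, j != a -> m j = l j) ->
    E m b = omega (x l b / x m a) * e_rest1 l b a.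
  exact: e_coef_split1.
have Eb' m : (forall j, j != a -> m j = box l b j) ->
    E m b = omega (q1 * x l b / x m a) * e_rest1 (box l b) b a.
  by move=> ml; rewrite (e_coef_split1 ab ml) xb eqxx.
rewrite /serre_path !e_path3 // !(boxC l b a) !Ea.
rewrite (@Eb (box l a)); last by move=> j ja; rewrite boxNE.
rewrite (@Eb l) // (@Eb' (box (box l a) b)); last first.
  by move=> j ja; rewrite boxC boxNE.
rewrite (@Eb' (box l b)) // !xb ?eqxx !(negPf nab.1) !(negPf nab.2) !mul1r.
(* The first box in column [b] may already be forbidden, in which case the pole
   at the second one is not excluded but every path has coefficient zero. *)
have Xt : omega (x l b / x l a) * e_rest1 l b a = 0 \/
    x l a != q1 * (q1 * x l b).
  have [abl|nabl] := boolP (adm (box l b)).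
    right; rewrite -[x l a](@x_box_neq F N q1 q3 u l b a) ?nab //.
    rewrite -[q1 * x l b](@x_box_eq F N q1 q3 u q1_neq0).
    apply: (@not_tight2 (box l b) b a) => //; last by rewrite inE eqxx.
    by rewrite (boxC (box l b) b a) (boxC l b a).
  by left; rewrite -Eb // e_coef_not_adm.
move: Xt xab (xn0 l a) (xn0 l b) (x_neq al ab) (x_neq_shift al ab).
move: (x l a) (x l b) (E l a) (e_rest1 l b a) (e_rest1 (box l b) b a).
move=> X Y A B B' h01 h1 X0 Y0 h2 h3.
have -> : q1 * Y / (q1 * X) = Y / X by rewrite -mulf_div divff ?mul1r.
case: h01 => [oB|h0].
  transitivity (omega (Y / X) * B * A * B' *
    (serre_weight Y (q1 * Y) X * omega (q1 * Y / X)
  + serre_weight Y X (q1 * Y) * omega (Y / X)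
  + serre_weight X Y (q1 * Y) * omega (Y / (q1 * X)))); first by ring.
  by rewrite oB !mul0r.
have := serre_double_big q1_neq0 q3_neq0 X0 Y0 h2 h3 h1 h0.
set s := (X in X = 0) => s0.
transitivity (s * (omega (Y / X) * B * A * B')); first by rewrite /s; ring.
by rewrite s0 mul0r.
Qed.

Lemma serre_repeat3 l a : serre_path l a a a = 0.
Proof.
rewrite /serre_path /serre_weight !xb eqxx.
move: (x l a) (xn0 l a) => y y0; apply/eqP; rewrite mulf_eq0; apply/orP; left.
by apply/eqP; field; rewrite y0 q1_neq0.
Qed.

Definition serre_orbit l a b c : F :=
  serre_path l a b c + serre_path l a c b + serre_path l b a c +
  serre_path l b c a + serre_path l c a b + serre_path l c b a.

Lemma serre_orbit_eq0 l a b c : adm l -> serre_orbit l a b c = 0.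
Proof.
move=> al.
wlog ab : a b c / (a <= b)%N => [hw|].
  case/orP: (leq_total a b) => ab; first exact: hw.
  by rewrite -(hw b a c ab) /serre_orbit; ring.
wlog bc : a b c ab / (b <= c)%N => [hw|].
  case/orP: (leq_total b c) => bc; first exact: hw.
  case/orP: (leq_total a c) => ac.
    by rewrite -(hw a c b ac bc) /serre_orbit; ring.
  by rewrite -(hw c a b ac ab) /serre_orbit; ring.
have [am|nam] := boolP (adm (box (box (box l a) b) c)); last first.
  have e1 := boxC (box l a) c b; have e2 := boxC l b a; have e3 := boxC l c a.
  have e4 := boxC (box l b) c a; have e5 := boxC l c b.
  by rewrite /serre_orbit !serre_path_eq0 ?addr0 //;
    rewrite ?e5 ?e4 ?e3 ?e2 ?e1 ?e2.
move: ab bc; rewrite leq_eqVlt => /orP[/eqP/val_inj ab|ab];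
  rewrite leq_eqVlt => /orP[/eqP/val_inj bc|bc].
- by rewrite -bc -ab /serre_orbit serre_repeat3 !addr0.
- rewrite -ab in am *.
  transitivity (2%:R * (serre_path l a a c + serre_path l a c a +
    serre_path l c a a)); first by rewrite /serre_orbit; ring.
  by rewrite serre_repeat_first ?mulr0 // ab.
- rewrite -bc in am *.
  transitivity (2%:R * (serre_path l a b b + serre_path l b a b +
    serre_path l b b a)); first by rewrite /serre_orbit; ring.
  by rewrite serre_repeat_last ?mulr0.
- exact: serre_distinct.
Qed.

End CoefficientRelations.

(** * Power series quotients and partial fractions *)

Section Series.
Variable F : fieldType.
Implicit Types (s : nat -> F) (d e num den : {poly F}) (n : nat).

(** A power series is the function of its coefficients; this is its product with
    a polynomial. *)
Definition serM s d n : F := \sum_(i < n.+1) s i * d`_(n - i).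

Lemma eq_serM s s' d : s =1 s' -> serM s d =1 serM s' d.
Proof. by move=> ss n; apply: eq_bigr => i _; rewrite ss. Qed.

Lemma serM_coef (p d : {poly F}) n : serM (nth 0 p) d n = (p * d)`_n.
Proof. by rewrite coefM. Qed.

Lemma serMM s d e n : serM s (d * e) n = serM (serM s d) e n.
Proof.
pose p := \poly_(i < n.+1) s i.
have pE i : (i <= n)%N -> p`_i = s i by move=> le_in; rewrite coef_poly ltnS le_in.
transitivity ((p * d * e)`_n).
  by rewrite -mulrA coefM; apply: eq_bigr => i _; rewrite pE // -ltnS.
rewrite coefM; apply: eq_bigr => i _; congr (_ * _); rewrite coefM.
apply: eq_bigr => j _; rewrite pE //.
by rewrite -ltnS (leq_trans (ltn_ord j)).
Qed.

Lemma serMD s s' d n : serM (fun i => s i + s' i) d n = serM s d n + serM s' d n.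
Proof. by rewrite -big_split; apply: eq_bigr => i _; rewrite mulrDl. Qed.

Lemma serM_sum (I : finType) (P : pred I) (c : I -> F) (s : I -> nat -> F) d n :
  serM (fun i => \sum_(j | P j) c j * s j i) d n =
  \sum_(j | P j) c j * serM (s j) d n.
Proof.
rewrite /serM; under eq_bigr do rewrite mulr_suml.
rewrite exchange_big; apply: eq_bigr => j _; rewrite mulr_sumr.
by apply: eq_bigr => i _; rewrite mulrA.
Qed.

Lemma serM_inj s s' d : d`_0 != 0 -> serM s d =1 serM s' d -> s =1 s'.
Proof.
move=> d0 e n; have [m] := ubnP n; elim: m n => // m IHm n le_nm.
have := e n; rewrite /serM !big_ord_recr /= subnn.
rewrite (eq_bigr (fun i : 'I_n => s' i * d`_(n - i))); last first.
  by move=> i _; rewrite IHm // (leq_trans (ltn_ord i)).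
by move/addrI/(mulIf d0).
Qed.

Lemma pexpand_unique num den s :
  den`_0 != 0 -> (forall n, serM s den n = num`_n) -> pexpand num den =1 s.
Proof.
move=> den0 sP; apply: (serM_inj den0) => n.
by rewrite sP; apply: pexpandP.
Qed.

Lemma pexpand_cancel d num den : d`_0 != 0 -> den`_0 != 0 ->
  pexpand (d * num) (d * den) =1 pexpand num den.
Proof.
move=> d0 den0; apply: pexpand_unique; first by rewrite coef0M mulf_neq0.
move=> n; rewrite mulrC serMM -[RHS]/((d * num)`_n) [d * num]mulrC -serM_coef.
by apply: eq_serM => i; apply: pexpandP.
Qed.

Lemma serM_geom (p : F) n :
  serM (fun i => if i is i'.+1 then p ^+ i' else 0) (1 - p *: 'X) n = 'X`_n.
Proof.
rewrite /serM; case: n => [|[|n]].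
- by rewrite big_ord1 mul0r coefX.
- by rewrite !big_ord_recr big_ord0 /= !coefE /= mul0r !add0r mulr0 subr0 mulr1.
rewrite !big_ord_recr /= big1 => [|i _]; last first.
  have -> : (n.+2 - i = (n - i).+2)%N by have := ltn_ord i; lia.
  by rewrite !coefE /= mulr0 subr0 mulr0.
have -> : (n.+2 - n = 2)%N by lia.
by rewrite subnn subSnn !coefE /= !exprS; ring.
Qed.

Lemma serM_geomV (p : F) n : p != 0 ->
  serM (fun i => - p^-1 ^+ i.+1) ('X - p%:P) n = (1 : {poly F})`_n.
Proof.
move=> p0; rewrite /serM; case: n => [|n].
  by rewrite big_ord1 !coefE /= expr1 add0r mulrNN mulVf.
rewrite !big_ord_recr /= big1 => [|i _]; last first.
  have -> : (n.+1 - i = (n - i.+1).+2)%N by have := ltn_ord i; lia.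
  by rewrite !coefE /= subr0 mulr0.
by rewrite subnn subSnn !coefE /= !exprS; field.
Qed.

End Series.

Section PartialFractions.
Variables (F : fieldType) (T : finType) (p z : T -> F).
Hypothesis p_neq0 : forall t, p t != 0.
Implicit Types (S Z B : {set T}) (s t : T).

(** For the rational function with zeros [z] on [Z] and poles [p] on [S], in the
    variable [1 / X], this is the coefficient of [1 / (1 - p s * X)] in the
    partial fraction decomposition. *)
Definition residue S Z s : F :=
  (\prod_(t in Z) (1 - z t / p s)) / (\prod_(t in S | t != s) (1 - p t / p s)).

Lemma eq_poly_on_points (A B : {poly F}) (rs : seq F) : uniq rs ->
  (size (A - B)%R <= size rs)%N -> (forall a, a \in rs -> A.[a] = B.[a]) -> A = B.
Proof.
move=> urs sz eqAB; apply/eqP; rewrite -subr_eq0; apply/eqP.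
apply: (@roots_geq_poly_eq0 _ _ rs) => //.
by apply/allP => a /eqAB e; rewrite rootE !hornerE e subrr.
Qed.

Lemma size_prod_lin (I : finType) (P : pred I) (f : I -> {poly F}) :
  (forall i, P i -> (size (f i) <= 2)%N) ->
  (size (\prod_(i | P i) f i)%R <= #|P|.+1)%N.
Proof.
move=> sf; rewrite -sum1_card; elim/big_rec2: _ => [|i n y Pi IH].
  by rewrite size_poly1.
apply: leq_trans (size_polyMleq _ _) _; have := sf i Pi; lia.
Qed.

Lemma size_1subZX (a : F) : (size (1 - a *: 'X)%R <= 2)%N.
Proof.
apply: leq_trans (size_polyD _ _) _; rewrite size_poly1 size_polyN.
by rewrite geq_max /=; apply: leq_trans (size_scale_leq _ _) _; rewrite size_polyX.
Qed.

Section Simple.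
Variables (S Z : {set T}).
Hypotheses (SZ : #|S| = #|Z|) (p_inj : {in S &, injective p}).

Let den s : F := \prod_(t in S | t != s) (1 - p t / p s).

Lemma simple_den_neq0 s : s \in S -> den s != 0.
Proof.
move=> sS; apply/prodf_neq0 => t /andP[tS ts].
rewrite subr_eq0 eq_sym; apply: contra ts => /eqP e; apply/eqP/p_inj => //.
by rewrite -[RHS]mul1r -e divfK.
Qed.

(** Both sides have degree at most [#|S|] and agree at [0] and at the inverses of
    the poles. *)
Lemma pfrac_infinity :
  \prod_(t in Z) (1 - z t *: 'X) = \prod_(t in S) (1 - p t *: 'X) +
   \sum_(s in S) (residue S Z s * p s) *:
     ('X * \prod_(t in S | t != s) (1 - p t *: 'X)).
Proof.
apply: (@eq_poly_on_points _ _ (0 :: [seq (p s)^-1 | s <- enum S])).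
- rewrite /= map_inj_in_uniq ?enum_uniq; last first.
    by move=> s t; rewrite !mem_enum => sS tS /invr_inj; apply: p_inj.
  rewrite andbT; apply/mapP => -[s _ /eqP].
  by rewrite eq_sym invr_eq0 (negPf (p_neq0 s)).
- rewrite /= size_map -cardE; apply: leq_trans (size_polyD _ _) _.
  rewrite size_polyN geq_max; apply/andP; split.
    rewrite SZ; apply: leq_trans (size_prod_lin _) _ => // t _.
    exact: size_1subZX.
  apply: leq_trans (size_polyD _ _) _; rewrite geq_max; apply/andP; split.
    by apply: leq_trans (size_prod_lin _) _ => // t _; apply: size_1subZX.
  apply: leq_trans (size_sum _ _ _) _; apply/bigmax_leqP => s sS.
  apply: leq_trans (size_scale_leq _ _) _.
  apply: leq_trans (size_polyMleq _ _) _; rewrite size_polyX /=.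
  apply: leq_trans (size_prod_lin _) _; first by move=> t _; apply: size_1subZX.
  rewrite (cardsD1 s S) sS add1n ltnS; apply: eq_leq; apply: eq_card => t.
  by rewrite !inE unfold_in andbC.
move=> a; rewrite inE => /orP[/eqP->|/mapP[s]].
  rewrite hornerD horner_sum !horner_prod [X in _ = _ + X]big1; last first.
    by move=> t _; rewrite hornerZ hornerM hornerX mul0r mulr0.
  by rewrite addr0 !big1 // => t _; rewrite !hornerE ?mulr0 ?subr0.
rewrite mem_enum => sS ->.
rewrite hornerD horner_sum !horner_prod (bigD1 s sS) /= !hornerE.
rewrite mulfV ?p_neq0 // subrr mul0r add0r.
rewrite (bigD1 s sS) /= [X in _ + X]big1 ?addr0; last first.
  move=> t /andP[tS ts]; rewrite !hornerE horner_prod (bigD1 s) /=; last first.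
    by rewrite sS eq_sym.
  by rewrite !hornerE mulfV ?p_neq0 // subrr /= mulr0 mul0r.
rewrite hornerZ hornerM hornerX horner_prod mulrA mulfK ?p_neq0 //.
have ev (c : F) : (1 - c *: 'X).[(p s)^-1] = 1 - c / p s by rewrite !hornerE.
rewrite (eq_bigr _ (fun t _ => ev (z t))) [in RHS](eq_bigr _ (fun t _ => ev (p t))).
by rewrite divfK // simple_den_neq0.
Qed.

(** Both products being monic, the difference has degree less than [#|S|], so it
    suffices to compare values at the poles. *)
Lemma pfrac_zero :
  \prod_(t in Z) ('X - (z t)%:P) = \prod_(t in S) ('X - (p t)%:P) +
   \sum_(s in S) (residue S Z s * p s) *:
     (\prod_(t in S | t != s) ('X - (p t)%:P)).
Proof.
apply: (@eq_poly_on_points _ _ [seq p s | s <- enum S]).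
- by rewrite map_inj_in_uniq ?enum_uniq // => s t; rewrite !mem_enum; apply: p_inj.
- rewrite size_map -cardE opprD addrA.
  apply: leq_trans (size_polyD _ _) _; rewrite geq_max size_polyN.
  have monZ : \prod_(t in Z) ('X - (z t)%:P) \is monic.
    by apply: monic_prod => t _; apply: monicXsubC.
  have monS : \prod_(t in S) ('X - (p t)%:P) \is monic.
    by apply: monic_prod => t _; apply: monicXsubC.
  have szZ : size (\prod_(t in Z) ('X - (z t)%:P))%R = #|S|.+1.
    by rewrite -big_enum size_prod_XsubC -cardE SZ.
  have szS : size (\prod_(t in S) ('X - (p t)%:P))%R = #|S|.+1.
    by rewrite -big_enum size_prod_XsubC -cardE.
  apply/andP; split.
    apply/leq_sizeP => j; rewrite leq_eqVlt => /orP[/eqP<-|lt_j]; rewrite coefB.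
      move/monicP: monZ; move/monicP: monS.
      by rewrite /lead_coef szZ szS /= => -> ->; rewrite subrr.
    by rewrite !nth_default ?subrr ?szZ ?szS.
  apply: leq_trans (size_sum _ _ _) _; apply/bigmax_leqP => s sS.
  apply: leq_trans (size_scale_leq _ _) _.
  apply: leq_trans (size_prod_lin _) _; first by move=> t _; rewrite size_XsubC.
  rewrite (cardsD1 s S) sS add1n ltnS; apply: eq_leq; apply: eq_card => t.
  by rewrite !inE unfold_in andbC.
move=> _ /mapP[s + ->]; rewrite mem_enum => sS.
rewrite hornerD horner_sum !horner_prod [in RHS](bigD1 s sS) /= hornerXsubC.
rewrite subrr mul0r add0r.
rewrite [in RHS](bigD1 s sS) /= [X in _ + X]big1 ?addr0; last first.
  move=> t /andP[tS ts]; rewrite hornerZ horner_prod (bigD1 s) /=; last first.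
    by rewrite sS eq_sym.
  by rewrite hornerXsubC subrr mul0r mulr0.
rewrite hornerZ horner_prod.
have ev (c : F) : ('X - c%:P).[p s] = p s * (1 - c / p s).
  by rewrite hornerXsubC; field; rewrite p_neq0.
rewrite (eq_bigr _ (fun t _ => ev (z t))) [in RHS](eq_bigr _ (fun t _ => ev (p t))).
rewrite !big_split /= !prodr_const -SZ /residue.
have -> : #|[pred t in S | t != s]| = #|S|.-1.
  by rewrite (cardsD1 s S) sS; apply: eq_card => t; rewrite !inE unfold_in andbC.
have -> : p s ^+ #|S| = p s * p s ^+ #|S|.-1.
  by rewrite -exprS prednK // (cardsD1 s S) sS.
have := simple_den_neq0 sS; rewrite /den; set D := \prod_(t in S | _) _ => D0.
by field.
Qed.

Lemma pexpand_infinity n :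
  pexpand (\prod_(t in Z) (1 - z t *: 'X)) (\prod_(t in S) (1 - p t *: 'X)) n =
  if n is n'.+1 then \sum_(s in S) residue S Z s * p s ^+ n else 1.
Proof.
have lin0 (I : finType) (P : pred I) (c : I -> F) :
    (\prod_(t | P t) (1 - c t *: 'X))`_0 = 1.
  rewrite -horner_coef0 horner_prod big1 // => t _.
  by rewrite !hornerE ?mulr0 ?subr0.
pose geo (s : T) i := if i is i'.+1 then p s ^+ i' else 0.
pose ser i := (1 : {poly F})`_i + \sum_(s in S) residue S Z s * p s * geo s i.
rewrite (@pexpand_unique _ _ _ ser).
- rewrite /ser coef1; case: n => [|n] /=.
    by rewrite big1 ?addr0 // => s _; rewrite mulr0.
  by rewrite add0r; apply: eq_bigr => s _; rewrite exprS mulrA.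
- by rewrite lin0 oner_neq0.
- move=> m; rewrite serMD serM_coef mul1r pfrac_infinity coefD; congr (_ + _).
  rewrite serM_sum coef_sum; apply: eq_bigr => s sS; rewrite coefZ; congr (_ * _).
  rewrite (bigD1 s sS) /= serMM -serM_coef.
  by apply: eq_serM => i; rewrite serM_geom.
Qed.

Lemma pexpand_zero n :
  pexpand (\prod_(t in Z) ('X - (z t)%:P)) (\prod_(t in S) ('X - (p t)%:P)) n =
  (n == 0%N)%:R - \sum_(s in S) residue S Z s * (p s)^-1 ^+ n.
Proof.
pose geo (s : T) i := - (p s)^-1 ^+ i.+1.
pose ser i := (1 : {poly F})`_i + \sum_(s in S) residue S Z s * p s * geo s i.
rewrite (@pexpand_unique _ _ _ ser).
- rewrite /ser coef1 -sumrN; congr (_ + _); apply: eq_bigr => s _.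
  by rewrite /geo exprS; move: (_ ^+ n) (p_neq0 s) => a p0; field.
- rewrite -horner_coef0 horner_prod; apply/prodf_neq0 => t _.
  by rewrite hornerXsubC sub0r oppr_eq0.
- move=> m; rewrite serMD serM_coef mul1r pfrac_zero coefD; congr (_ + _).
  rewrite serM_sum coef_sum; apply: eq_bigr => s sS; rewrite coefZ; congr (_ * _).
  rewrite (bigD1 s sS) /= serMM -[in RHS](mul1r (\prod_(t in S | _) _)) -serM_coef.
  by apply: eq_serM => i; rewrite serM_geomV.
Qed.

End Simple.
Section Degenerate.
Definition multiple_poles : {set T} := [set s | [exists t, (t != s) && (p t == p s)]].

Local Notation B := multiple_poles.

Variable phi : T -> T.
Hypotheses (phi_inj : injective phi) (phiP : {in B, forall s, z (phi s) = p s}).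

Lemma multiple_poleP s :
  reflect (exists2 t, t != s & p t = p s) (s \in B).
Proof.
rewrite inE; apply: (iffP existsP) => [[t /andP[ts /eqP e]]|[t ts e]].
  by exists t.
by exists t; rewrite ts e eqxx.
Qed.

Lemma simple_poleP s t : s \notin B -> t != s -> p t != p s.
Proof.
by move=> sB ts; apply: contraNneq sB => e; apply/multiple_poleP; exists t => //.
Qed.

Lemma cancel_zeros (R : comNzRingType) (f : F -> R) :
  \prod_t f (z t) = (\prod_(s in B) f (p s)) * \prod_(t in ~: (phi @: B)) f (z t).
Proof.
rewrite (bigID [in phi @: B]) /=; congr (_ * _).
  by rewrite big_imset /= => [|s t _ _ /phi_inj//]; apply: eq_bigr => s /phiP->.
by apply: eq_bigl => t; rewrite in_setC.
Qed.

Lemma cancel_poles (R : comNzRingType) (f : F -> R) :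
  \prod_t f (p t) = (\prod_(s in B) f (p s)) * \prod_(t in ~: B) f (p t).
Proof.
by rewrite (bigID [in B]) /=; congr (_ * _); apply: eq_bigl => t; rewrite in_setC.
Qed.

(** At a multiple pole the second product vanishes, and so does this quotient. *)
Definition total_residue s : F :=
  (\prod_t (1 - z t / p s)) / (\prod_(t | t != s) (1 - p t / p s)).

Lemma total_residueE s : total_residue s =
  if s \in B then 0 else residue (~: B) (~: (phi @: B)) s.
Proof.
rewrite /total_residue; case: ifP => sB.
  have /multiple_poleP[t ts e] := sB; rewrite [X in _ / X](bigD1 t) //= e.
  rewrite divff ?p_neq0 //.
  by rewrite subrr mul0r invr0 mulr0.
have -> : \prod_(t | t != s) (1 - p t / p s) =
    (\prod_(t in B) (1 - p t / p s)) * \prod_(t in ~: B | t != s) (1 - p t / p s).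
  rewrite (bigID [in B]) /=; congr (_ * _); apply: eq_bigl => t.
    by case: (t =P s) => [->|_] //=; rewrite sB.
  by rewrite in_setC andbC.
rewrite (cancel_zeros (fun c => 1 - c / p s)) /residue.
rewrite -mulf_div divff ?mul1r; last first.
  apply/prodf_neq0 => t tB; have ts : t != s by apply: contraTneq tB => ->; rewrite sB.
  rewrite subr_eq0; apply: contraNneq (simple_poleP (negbT sB) ts) => e.
  by rewrite -[X in _ == X]mul1r e divfK.
by [].
Qed.

(** The formal counterpart of the residue theorem: a term [1 / (1 - p / X)] has as
    difference of its expansions in [1 / X] and in [X] the two-sided series of all
    powers of [p / X].  Multiple poles are allowed when the map [phi] matches
    them with zeros, for then numerator and denominator can be divided by the
    same product. *)
Lemma pexpand_difference (n : int) :
  (if 0 <= n then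
     pexpand (\prod_t (1 - z t *: 'X)) (\prod_t (1 - p t *: 'X)) `|n|%N
   else 0) -
  (if n <= 0 then
     pexpand (\prod_t ('X - (z t)%:P)) (\prod_t ('X - (p t)%:P)) `|n|%N
   else 0) = \sum_s total_residue s * p s ^ n.
Proof.
pose S := ~: B; pose Z := ~: (phi @: B).
have SZ : #|S| = #|Z| by rewrite (cardsCs S) (cardsCs Z) !setCK card_imset.
have p_injS : {in S &, injective p}.
  move=> s t; rewrite !in_setC => sB tB e; apply/eqP; apply: contraTT isT => st.
  by have := simple_poleP tB st; rewrite e eqxx.
have -> : \sum_s total_residue s * p s ^ n = \sum_(s in S) residue S Z s * p s ^ n.
  rewrite (bigID [in B]) /= big1 ?add0r => [|s sB]; last first.
    by rewrite total_residueE sB mul0r.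
  by apply: eq_big => [s|s /negPf sB]; rewrite ?in_setC // total_residueE sB.
have lin0 (P : pred T) (c : T -> F) :
    (\prod_(t | P t) (1 - c t *: 'X))`_0 != 0.
  rewrite -horner_coef0 horner_prod big1 ?oner_neq0 // => t _.
  by rewrite !hornerE ?mulr0 ?subr0.
have linX0 (P : pred T) : (\prod_(t | P t) ('X - (p t)%:P))`_0 != 0.
  rewrite -horner_coef0 horner_prod; apply/prodf_neq0 => t _.
  by rewrite hornerXsubC sub0r oppr_eq0.
rewrite (cancel_zeros (fun c => 1 - c *: 'X)) (cancel_poles (fun c => 1 - c *: 'X)).
rewrite (cancel_zeros (fun c => 'X - c%:P)) (cancel_poles (fun c => 'X - c%:P)).
rewrite !pexpand_cancel // pexpand_infinity // pexpand_zero //.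
case: n => [[|n]|n] //=.
- by rewrite subKr; apply: eq_bigr => s _; rewrite expr0.
- by rewrite subr0.
- by rewrite !sub0r opprK; apply: eq_bigr => s _; rewrite exprVn.
Qed.

End Degenerate.
End PartialFractions.

(** * The eigenvalues of the Cartan currents *)

Section Windows.
Variable F : fieldType.
Implicit Types (s : nat -> F) (d : {poly F}).

Definition extend0 s (n : int) : F := if 0 <= n then s `|n|%N else 0.

(** Multiplication by a cubic polynomial combines four consecutive coefficients;
    extending the series by zero makes this uniform in the degree. *)
Lemma serM_window s d (n : int) : (size d <= 4)%N ->
  d`_0 * extend0 s n + d`_1 * extend0 s (n - 1) + d`_2 * extend0 s (n - 2) +
  d`_3 * extend0 s (n - 3) = if 0 <= n then serM s d `|n|%N else 0.
Proof.
move=> sd; have d0 i : (4 <= i)%N -> d`_i = 0.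
  by move=> i4; rewrite nth_default // (leq_trans sd).
have extE m : extend0 s (Posz m) = s m by [].
have extN m : extend0 s (Negz m) = 0 by [].
case: n => [[|[|[|n]]]|n] /=.
- rewrite /serM big_ord1 extE.
  by rewrite -[0 - 1]/(Negz 0) -[0 - 2]/(Negz 1) -[0 - 3]/(Negz 2) !extN; ring.
- rewrite /serM !big_ord_recr big_ord0 /= extE -[1%:Z - 1]/(0%:Z) extE.
  by rewrite -[1%:Z - 2]/(Negz 0) -[1%:Z - 3]/(Negz 1) !extN; ring.
- rewrite /serM !big_ord_recr big_ord0 /= extE -[2%:Z - 1]/(1%:Z) extE.
  rewrite -[2%:Z - 2]/(0%:Z) extE.
  by rewrite -[2%:Z - 3]/(Negz 0) !extN; ring.
- have -> : n.+3%:Z - 1 = n.+2%:Z by lia.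
  have -> : n.+3%:Z - 2 = n.+1%:Z by lia.
  have -> : n.+3%:Z - 3 = n%:Z by lia.
  rewrite !extE /serM !big_ord_recr /= big1 => [|i _]; last first.
    by rewrite d0 ?mulr0 //; have := ltn_ord i; lia.
  have -> : (n.+3 - n = 3)%N by lia.
  have -> : (n.+3 - n.+1 = 2)%N by lia.
  by rewrite subSnn subnn; ring.
- have -> : Negz n - 1 = Negz n.+1 by lia.
  have -> : Negz n - 2 = Negz n.+2 by lia.
  have -> : Negz n - 3 = Negz n.+3 by lia.
  by rewrite !extN; ring.
Qed.

Lemma window_eq s s' d d' (n : int) : (size d <= 4)%N -> (size d' <= 4)%N ->
    serM s' d' =1 serM s d ->
  d'`_0 * extend0 s' n + d'`_1 * extend0 s' (n - 1) +
  d'`_2 * extend0 s' (n - 2) + d'`_3 * extend0 s' (n - 3) =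
  d`_0 * extend0 s n + d`_1 * extend0 s (n - 1) + d`_2 * extend0 s (n - 2) +
  d`_3 * extend0 s (n - 3).
Proof. by move=> sd sd' e; rewrite !serM_window // e. Qed.

End Windows.

Section CartanSeries.
Variables (F : fieldType) (N : nat) (q1 q2 q3 u : F).
Hypotheses (u_neq0 : u != 0) (q1_neq0 : q1 != 0) (q3_neq0 : q3 != 0).
Hypothesis q123 : q1 * q2 * q3 = 1.

Local Notation weight := {ffun 'I_N -> int}.
Local Notation x := (@psi_c N F q1 q3 u).
Local Notation G s := ((gpoly q1 q2 q3)`_s).
Implicit Types (l : weight) (i j : 'I_N) (f : F -> {poly F}).

Lemma psi_aE l i : psi_a q1 q3 u l i = q3 * x l i.
Proof. by rewrite /psi_a /psi_c expfzDr // expr1z; ring. Qed.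

Lemma psi_dE l i : psi_d q1 q3 u l i = x l i / q1.
Proof. by rewrite /psi_d /psi_c expfzDr // exprN1; ring. Qed.

Lemma psi_bE l i : psi_b q1 q3 u l i = q2 * x l i.
Proof.
rewrite /psi_b /psi_c !expfzDr // !exprN1 (q2E q1_neq0 q3_neq0 q123).
by field; rewrite q1_neq0 q3_neq0.
Qed.

(** The numerator and the denominator of the eigenvalue, for both expansions: [f c]
    is a linear polynomial with root [1 / c] in the expansion at infinity and
    [c] in the expansion at zero. *)
Definition zeros_prod f l : {poly F} :=
  \prod_(i < N) (f (psi_a q1 q3 u l i) * f (psi_b q1 q3 u l i)).
Definition poles_prod f l : {poly F} :=
  \prod_(i < N) (f (psi_c q1 q3 u l i) * f (psi_d q1 q3 u l i)).

Let at_infinity (c : F) : {poly F} := 1 - c *: 'X.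
Let at_zero (c : F) : {poly F} := 'X - c%:P.

Lemma zeros_prod_infinity0 l : (zeros_prod at_infinity l)`_0 = 1.
Proof.
rewrite -horner_coef0 horner_prod big1 // => i _.
by rewrite !hornerE ?mulr0 ?subr0 ?mulr1.
Qed.

Lemma poles_prod_infinity0 l : (poles_prod at_infinity l)`_0 = 1.
Proof.
rewrite -horner_coef0 horner_prod big1 // => i _.
by rewrite !hornerE ?mulr0 ?subr0 ?mulr1.
Qed.

Lemma poles_prod_zero0 l :
  (poles_prod at_zero l)`_0 = \prod_(i < N) (x l i * (x l i / q1)).
Proof.
rewrite -horner_coef0 horner_prod; apply: eq_bigr => i _.
by rewrite hornerM !hornerXsubC !sub0r mulrNN psi_dE.
Qed.

Lemma zeros_prod_zero0 l : (zeros_prod at_zero l)`_0 = (poles_prod at_zero l)`_0.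
Proof.
rewrite poles_prod_zero0 -horner_coef0 horner_prod; apply: eq_bigr => i _.
rewrite hornerM !hornerXsubC !sub0r mulrNN psi_aE psi_bE.
rewrite (q2E q1_neq0 q3_neq0 q123); field; by rewrite q1_neq0 q3_neq0.
Qed.

Lemma poles_prod_zero_neq0 l : (poles_prod at_zero l)`_0 != 0.
Proof.
rewrite poles_prod_zero0; apply/prodf_neq0 => i _.
have x0 := x_neq0 u_neq0 q1_neq0 q3_neq0 l i.
by rewrite (mulf_neq0 x0) // (mulf_neq0 x0) // invr_eq0.
Qed.

Lemma psip_eig0 l : psip_eig q1 q3 u 0 l = 1.
Proof.
rewrite /psip_eig -/(zeros_prod at_infinity l) -/(poles_prod at_infinity l) /=.
by rewrite zeros_prod_infinity0 poles_prod_infinity0 divr1.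
Qed.

Lemma psim_eig0 l : psim_eig q1 q3 u 0 l = 1.
Proof.
rewrite /psim_eig -/(zeros_prod at_zero l) -/(poles_prod at_zero l) /=.
by rewrite zeros_prod_zero0 divff // poles_prod_zero_neq0.
Qed.

(** Up to the order of the factors both sides are the same product: adding a box
    moves [q3 * y] to [y / q2], [q2 * y] to [y / q3], and the poles [y] and
    [y / q1] to [q1 * y] and [y]. *)
Lemma box_exchange f l i (y := x l i) :
  zeros_prod f (box l i) * (f (q1 * y) * f (q2 * y) * f (q3 * y)) *
  poles_prod f l =
  zeros_prod f l * (f (y / q1) * f (y / q2) * f (y / q3)) *
  poles_prod f (box l i).
Proof.
rewrite /zeros_prod /poles_prod !(bigD1 i (P := xpredT)) //=.
have xj j : j != i -> x (box l i) j = x l j.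
  by move=> ji; rewrite x_box_neq // eq_sym.
rewrite (eq_bigr (fun j => f (psi_a q1 q3 u l j) * f (psi_b q1 q3 u l j))); last first.
  by move=> j ji; rewrite !psi_aE !psi_bE xj.
rewrite [in RHS](eq_bigr (fun j => f (psi_c q1 q3 u l j) * f (psi_d q1 q3 u l j))
  (P := fun j => j != i) (F1 := fun j => f (x (box l i) j) * _)); last first.
  by move=> j ji; rewrite !psi_dE xj.
rewrite !psi_aE !psi_bE !psi_dE x_box_eq // -/y.
have -> : q3 * (q1 * y) = y / q2.
  by rewrite (q2E q1_neq0 q3_neq0 q123) invrK; ring.
have -> : q2 * (q1 * y) = y / q3.
  by rewrite (q2E q1_neq0 q3_neq0 q123); field; rewrite q1_neq0 q3_neq0.
have -> : q1 * y / q1 = y by rewrite mulrAC divff ?mul1r.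
by ring.
Qed.

Lemma series_exchange f (s s' : nat -> F) l i (y := x l i) :
    (poles_prod f l)`_0 != 0 -> (poles_prod f (box l i))`_0 != 0 ->
    (forall n, serM s (poles_prod f l) n = (zeros_prod f l)`_n) ->
    (forall n, serM s' (poles_prod f (box l i)) n = (zeros_prod f (box l i))`_n) ->
  serM s' (f (q1 * y) * f (q2 * y) * f (q3 * y)) =1
  serM s (f (y / q1) * f (y / q2) * f (y / q3)).
Proof.
move=> d0 d0' sP sP'; set A := _ * f (q3 * y); set B := _ * f (y / q3).
pose D := poles_prod f l; pose D' := poles_prod f (box l i).
apply: (@serM_inj _ _ _ (D * D')); first by rewrite coef0M mulf_neq0.
move=> n; rewrite -!serMM.
have -> : A * (D * D') = D' * (A * D) by ring.
have -> : B * (D * D') = D * (B * D') by ring.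
rewrite serMM (eq_serM _ sP') serM_coef [in RHS]serMM (eq_serM _ sP) serM_coef.
rewrite (mulrA (zeros_prod f (box l i))) (mulrA (zeros_prod f l)).
by rewrite /A /B /y box_exchange.
Qed.

Lemma size_triple f a b c : (forall e, (size (f e) <= 2)%N) ->
  (size (f a * f b * f c)%R <= 4)%N.
Proof.
move=> sf; apply: leq_trans (size_polyMleq _ _) _.
have := size_polyMleq (f a) (f b); have := sf a; have := sf b; have := sf c; lia.
Qed.

Lemma sum4 (V : nmodType) (h : nat -> V) :
  \sum_(s < 4) h s = h 0%N + h 1%N + h 2%N + h 3%N.
Proof. by rewrite !big_ord_recr big_ord0 /= add0r. Qed.

Lemma gpolyE : [/\ G 0 = - (q1 * q2 * q3), G 1 = q1 * q2 + q1 * q3 + q2 * q3,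
  G 2 = - (q1 + q2 + q3) & G 3 = 1].
Proof.
have -> : gpoly q1 q2 q3 = 'X^3 - (q1 + q2 + q3) *: 'X^2 +
    (q1 * q2 + q1 * q3 + q2 * q3) *: 'X - (q1 * q2 * q3)%:P.
  by rewrite /gpoly -!mul_polyC !(polyCD, polyCM); ring.
by split; rewrite !coefE /=; ring.
Qed.

Lemma triple_infinity a b c :
  at_infinity a * at_infinity b * at_infinity c =
  1 - (a + b + c) *: 'X + (a * b + a * c + b * c) *: 'X^2 - (a * b * c) *: 'X^3.
Proof.
by rewrite /at_infinity -!mul_polyC !(polyCD, polyCM); ring.
Qed.

Lemma triple_zero a b c :
  at_zero a * at_zero b * at_zero c =
  'X^3 - (a + b + c) *: 'X^2 + (a * b + a * c + b * c) *: 'X - (a * b * c)%:P.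
Proof.
by rewrite /at_zero -!mul_polyC !(polyCD, polyCM); ring.
Qed.

Definition psip_int (n : int) l : F :=
  if 0 <= n then psip_eig q1 q3 u `|n|%N l else 0.
Definition psim_int (n : int) l : F :=
  if n <= 0 then psim_eig q1 q3 u `|n|%N l else 0.

Lemma psip_exchange l i (m : int) (y := x l i) :
  \sum_(s < 4) G s * (psip_int (m + s%:Z) (box l i) * y ^+ (3 - s)) =
  - \sum_(s < 4) G s * (psip_int (m + (3 - s)%N%:Z) l * y ^+ s).
Proof.
pose P n := psip_eig q1 q3 u n l; pose P' n := psip_eig q1 q3 u n (box l i).
have dn0 l' : (poles_prod at_infinity l')`_0 != 0.
  by rewrite poles_prod_infinity0 oner_neq0.
have := @series_exchange at_infinity P P' l i (dn0 _) (dn0 _)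
  (fun n => pexpandP _ _ (dn0 _)) (fun n => pexpandP _ _ (dn0 _)).
have sz a b c := size_triple a b c (@size_1subZX F).
move/(window_eq (m + 3)%R (sz _ _ _) (sz _ _ _)).
rewrite !triple_infinity !coefE /= -/y.
have [g0 g1 g2 g3] := gpolyE.
rewrite (sum4 (fun s => G s * (psip_int (m + s%:Z) (box l i) * y ^+ (3 - s)))).
rewrite (sum4 (fun s => G s * (psip_int (m + (3 - s)%N%:Z) l * y ^+ s))).
rewrite g0 g1 g2 g3 -[(3 - 0)%N]/3%N -[(3 - 1)%N]/2%N.
rewrite -[(3 - 2)%N]/1%N -[(3 - 3)%N]/0%N.
have PE' z : extend0 P' z = psip_int z (box l i) by [].
have PE z : extend0 P z = psip_int z l by [].
rewrite !PE !PE' (_ : m + 3 - 1 = m + 2); last lia.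
rewrite (_ : m + 3 - 2 = m + 1); last lia.
rewrite (_ : m + 3 - 3 = m + 0); last lia.
rewrite (q2E q1_neq0 q3_neq0 q123).
move: (psip_int (m + 0) l) (psip_int (m + 1) l) (psip_int (m + 2) l).
move: (psip_int (m + 3) l) (psip_int (m + 0) (box l i)).
move: (psip_int (m + 1) (box l i)) (psip_int (m + 2) (box l i)).
move: (psip_int (m + 3) (box l i)) => a b c d e f g h.
set L := (X in X = _ -> _); set M := (X in _ = X -> _) => LM.
by transitivity L; [rewrite /L | rewrite LM /M]; field;
  rewrite q1_neq0 q3_neq0 ?oner_neq0.
Qed.

Lemma psim_exchange l i (m : int) (y := x l i) :
  \sum_(s < 4) G s * (psim_int (m + s%:Z) (box l i) * y ^+ (3 - s)) =
  - \sum_(s < 4) G s * (psim_int (m + (3 - s)%N%:Z) l * y ^+ s).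
Proof.
pose P n := psim_eig q1 q3 u n l; pose P' n := psim_eig q1 q3 u n (box l i).
have dn0 := poles_prod_zero_neq0.
have := @series_exchange at_zero P P' l i (dn0 _) (dn0 _)
  (fun n => pexpandP _ _ (dn0 _)) (fun n => pexpandP _ _ (dn0 _)).
have sX c : (size (at_zero c) <= 2)%N by rewrite size_XsubC.
have sz a b c := size_triple a b c sX.
move/(window_eq (- m)%R (sz _ _ _) (sz _ _ _)).
rewrite !triple_zero !coefE /= -/y.
have [g0 g1 g2 g3] := gpolyE.
rewrite (sum4 (fun s => G s * (psim_int (m + s%:Z) (box l i) * y ^+ (3 - s)))).
rewrite (sum4 (fun s => G s * (psim_int (m + (3 - s)%N%:Z) l * y ^+ s))).
rewrite g0 g1 g2 g3 -[(3 - 0)%N]/3%N -[(3 - 1)%N]/2%N.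
rewrite -[(3 - 2)%N]/1%N -[(3 - 3)%N]/0%N.
have PE' z : extend0 P' z = psim_int (- z) (box l i).
  by rewrite /psim_int /extend0 oppr_le0 abszN.
have PE z : extend0 P z = psim_int (- z) l.
  by rewrite /psim_int /extend0 oppr_le0 abszN.
rewrite !PE !PE' !opprB !opprK !(addrC _ m) !addr0.
rewrite (q2E q1_neq0 q3_neq0 q123).
move: (psim_int m l) (psim_int (m + 1) l) (psim_int (m + 2) l).
move: (psim_int (m + 3) l) (psim_int m (box l i)).
move: (psim_int (m + 1) (box l i)) (psim_int (m + 2) (box l i)).
move: (psim_int (m + 3) (box l i)) => a b c d e f g h.
set L := (X in X = _ -> _); set M := (X in _ = X -> _) => LM.
by transitivity L; [rewrite /L | rewrite LM /M]; field;
  rewrite q1_neq0 q3_neq0 ?oner_neq0.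
Qed.

End CartanSeries.

(** * The difference of the two expansions as a sum of residues *)

Section CartanResidues.
Variables (F : fieldType) (N k r : nat) (q1 q2 q3 u : F).
Hypotheses (k_ge1 : (1 <= k)%N) (r_ge2 : (2 <= r)%N).
Hypotheses (u_neq0 : u != 0) (q1_neq0 : q1 != 0) (q3_neq0 : q3 != 0).
Hypothesis q123 : q1 * q2 * q3 = 1.
Hypothesis only_resonance : forall n m : int,
  q1 ^ n * q3 ^ m = 1 <->
  exists a : int, n = (1 - r%:Z) * a /\ m = (k%:Z + 1) * a.

Local Notation weight := {ffun 'I_N -> int}.
Local Notation adm := (@admissible N k r).
Local Notation x := (@psi_c N F q1 q3 u).
Local Notation omega := (omega q1 q3).
Local Notation E := (e_coef q1 q3 u).
Implicit Types (l : weight) (i j : 'I_N).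

Let xn0 := @x_neq0 F N q1 q3 u u_neq0 q1_neq0 q3_neq0.

Lemma q1_neq1 : q1 != 1.
Proof.
clear -only_resonance.
apply/eqP => q11; have [+ _] := only_resonance 1 0.
by rewrite expr1z expr0z mulr1 => /(_ q11)[a []]; nia.
Qed.

Lemma q2_neq1 : q2 != 1.
Proof.
clear -k_ge1 r_ge2 q123 only_resonance.
apply/eqP => q21; have [+ _] := only_resonance 1 1.
by rewrite !expr1z -q123 q21 mulr1 => /(_ erefl)[a []]; nia.
Qed.

Lemma q3_neq1 : q3 != 1.
Proof.
clear -r_ge2 only_resonance.
apply/eqP => q31; have [+ _] := only_resonance 0 1.
by rewrite expr1z expr0z mul1r => /(_ q31)[a []]; nia.
Qed.

Definition f_coef l i : F := \prod_(j < N | (i < j)%N) omega (x l j / x l i).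

(** The poles are [x_i], with label [true], and [x_i / q1], with label [false]. *)
Definition pole l (s : 'I_N * bool) : F := if s.2 then x l s.1 else x l s.1 / q1.
Definition zero l (s : 'I_N * bool) : F := if s.2 then q3 * x l s.1 else q2 * x l s.1.

(** The factor of column [y] in the residue at the pole [w]. *)
Definition pair_factor (w y : F) : F :=
  ((1 - q3 * y / w) * (1 - q2 * y / w)) / ((1 - y / w) * (1 - y / q1 / w)).

Lemma frac_scale (c a b a' b' : F) :
  c != 0 -> a = c * a' -> b = c * b' -> a / b = a' / b'.
Proof. by move=> c0 -> ->; rewrite -mulf_div divff // mul1r. Qed.

Lemma pair_factor_before (w y : F) : w != 0 -> y != 0 ->
  omega (w / y) = pair_factor w y.
Proof.
move=> w0 y0; apply: (@frac_scale (q1 * w ^+ 2 / y ^+ 2)).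
- by rewrite !mulf_neq0 ?invr_eq0 ?expf_neq0.
- rewrite (q2E q1_neq0 q3_neq0 q123); field.
  by rewrite ?q1_neq0 ?q3_neq0 ?w0 ?y0.
- by field; rewrite ?q1_neq0 ?q3_neq0 ?w0 ?y0.
Qed.

Lemma pair_factor_after (w y : F) : w != 0 ->
  omega (y / (q1 * w)) = pair_factor w y.
Proof.
move=> w0; rewrite /omega /pair_factor (q2E q1_neq0 q3_neq0 q123).
apply: (@frac_scale 1); first exact: oner_neq0.
- by field; rewrite ?q1_neq0 ?q3_neq0 ?w0.
- by field; rewrite ?q1_neq0 ?q3_neq0 ?w0.
Qed.

Lemma big_pole (R : Type) (idx : R) (op : Monoid.com_law idx)
    (f : 'I_N * bool -> R) :
  \big[op/idx]_s f s = \big[op/idx]_(i < N) op (f (i, true)) (f (i, false)).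
Proof.
transitivity (\big[op/idx]_(s : 'I_N * bool) f (s.1, s.2)).
  by apply: eq_bigr => -[].
rewrite -(pair_bigA _ (fun i b => f (i, b))) /=; apply: eq_bigr => i _.
by rewrite big_bool.
Qed.

Lemma big_other_poles (R : comNzRingType) (f : 'I_N * bool -> R) i b :
  \prod_(s | s != (i, b)) f s =
  f (i, ~~ b) * \prod_(j < N | j != i) (f (j, true) * f (j, false)).
Proof.
rewrite (bigD1 (i, ~~ b)) /=; last by rewrite xpair_eqE eqxx; case: b.
congr (_ * _); transitivity (\prod_(s : 'I_N * bool | (s.1 != i) && xpredT s.2) f (s.1, s.2)).
  apply: eq_big => [|[]//] -[j c]; rewrite !xpair_eqE /= andbT.
  by case: (j == i); case: b; case: c.
rewrite -(pair_big (fun j => j != i) xpredT (fun j c => f (j, c))) /=.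
by apply: eq_bigr => j _; rewrite big_bool.
Qed.

Lemma prod_pair_factors l i (w : F) : w != 0 ->
  \prod_(j < N | j != i) pair_factor w (x l j) =
  (\prod_(j < N | (j < i)%N) omega (w / x l j)) *
  (\prod_(j < N | (i < j)%N) omega (x l j / (q1 * w))).
Proof.
move=> w0; rewrite (bigID (fun j : 'I_N => (j < i)%N)) /=; congr (_ * _).
  apply: eq_big => [j|j _]; last by rewrite pair_factor_before.
  by rewrite -val_eqE /=; case: ltngtP.
apply: eq_big => [j|j _]; last by rewrite pair_factor_after.
by rewrite -val_eqE /=; case: ltngtP.
Qed.

Lemma pole_residue l i b (w := pole l (i, b)) : w != 0 ->
  total_residue (pole l) (zero l) (i, b) =
  (1 - q3 * x l i / w) * (1 - q2 * x l i / w) / (1 - pole l (i, ~~ b) / w) *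
  ((\prod_(j < N | (j < i)%N) omega (w / x l j)) *
   (\prod_(j < N | (i < j)%N) omega (x l j / (q1 * w)))).
Proof.
move=> w0; rewrite -prod_pair_factors // /total_residue big_pole big_other_poles.
rewrite (bigD1 i) //= -/w -mulf_div -prodf_div.
by congr (_ * _); apply: eq_bigr => j _.
Qed.

(** Two poles coincide only at a tight pair [(j, i)], where [x_i = x_j / q1].  As
    [l_(i-1) = l_i] and [l_(j+1) = l_j], the zeros [q3 * x_(i-1)] and
    [q2 * x_(j+1)] are at that point as well. *)
Lemma multiple_pole_cancels l : adm l ->
  {in multiple_poles (pole l), forall s,
    zero l (if s.2 then (ord_pred s.1, true) else (ordS s.1, false)) = pole l s}.
Proof.
move=> al s /multiple_poleP[[j c] + +]; case: s => i b /=.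
have x_inj := x_inj k_ge1 r_ge2 u_neq0 q1_neq0 q3_neq0 only_resonance al.
have tightP (a d : 'I_N) (ad : (a < d)%N) :=
  x_tight k_ge1 r_ge2 u_neq0 q1_neq0 q3_neq0 only_resonance al ad.
have shift (a d : 'I_N) (ad : (a < d)%N) :=
  x_neq_shift k_ge1 r_ge2 u_neq0 q1_neq0 q3_neq0 only_resonance al ad.
have pole_eq (a d : 'I_N) : x l a = x l d / q1 -> tight k r l d a.
  move=> e0; have e : q1 * x l a = x l d by rewrite e0 mulrC divfK.
  case: (ltngtP a d) => ad.
  - by have := shift _ _ ad; rewrite e eqxx.
  - by apply/tightP.
  - move: e; rewrite -(val_inj ad) => /eqP.
    rewrite -subr_eq0 -{2}(mul1r (x l a)) -mulrBl mulf_eq0 subr_eq0.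
    by rewrite (negPf q1_neq1) (negPf (xn0 _ _)).
have q3x (a d : 'I_N) : d = a.+1 :> nat -> l d = l a -> q3 * x l a = x l d.
  by move=> da lda; rewrite /psi_c lda da -addn1 PoszD expfzDr // expr1z; ring.
case: b; case: c; rewrite /pole /zero /= => ne e.
- by move: ne; rewrite (x_inj _ _ e) eqxx.
- have t := pole_eq _ _ (esym e); have [ij _] := t.
  have i1E : ord_pred i = i.-1 :> nat.
    have := ltn_ord i; rewrite /ord_pred /=; have -> : (i + N).-1 = (N + i.-1)%N by lia.
    by rewrite modnDl => iN; rewrite modn_small //; lia.
  have i0 : i = (ord_pred i).+1 :> nat by rewrite i1E; lia.
  by apply: q3x => //; rewrite (tight_prev k_ge1 r_ge2 al t i0).
- have t := pole_eq _ _ e; have [ij _] := t.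
  have i1E : ordS i = i.+1 :> nat.
    by rewrite /ordS /= modn_small //; have := ltn_ord j; lia.
  rewrite -(q3x i (ordS i)) ?(tight_next k_ge1 r_ge2 al t i1E) //.
  rewrite (q2E q1_neq0 q3_neq0 q123).
  by field; rewrite q1_neq0 q3_neq0.
- by move/(mulIf (invr_neq0 q1_neq0))/x_inj: e ne => ->; rewrite eqxx.
Qed.

Definition unbox l i : weight := l - wunit i.

Lemma unboxK l i : box (unbox l i) i = l.
Proof. by rewrite /box /unbox subrK. Qed.

Lemma x_unbox_eq l i : x (unbox l i) i = x l i / q1.
Proof. by rewrite -{2}(unboxK l i) x_box_eq // mulrC mulKf. Qed.

Lemma x_unbox_neq l i j : i != j -> x (unbox l i) j = x l j.
Proof. by move=> ij; rewrite -{2}(unboxK l i) x_box_neq. Qed.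

Lemma psi_difference l (n : int) : adm l ->
  psip_int q1 q3 u n l - psim_int q1 q3 u n l =
  (1 - q2) * (1 - q3) * q1 / (1 - q1) *
  \sum_(i < N) (E (unbox l i) i * f_coef l i * (x l i / q1) ^ n -
                E l i * f_coef (box l i) i * x l i ^ n).
Proof.
move=> al.
have pn0 s : pole l s != 0.
  by case: s => i []; rewrite /pole /= ?xn0 // mulf_neq0 ?invr_eq0 ?xn0.
pose phi (s : 'I_N * bool) :=
  if s.2 then (ord_pred s.1, true) else (ordS s.1, false).
have phi_inj : injective phi.
  move=> [i b] [j c]; rewrite /phi; case: b; case: c => //= /(congr1 fst) /=.
    by move/ord_pred_inj->.
  by move/ordS_inj->.
have := pexpand_difference pn0 phi_inj (multiple_pole_cancels al) n.
have zE f : \prod_s f (zero l s) = zeros_prod q1 q3 u f l.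
  rewrite (big_pole _ (fun s => f (zero l s))); apply: eq_bigr => i _.
  by rewrite psi_aE // (psi_bE u q1_neq0 q3_neq0 q123).
have pE f : \prod_s f (pole l s) = poles_prod q1 q3 u f l.
  rewrite (big_pole _ (fun s => f (pole l s))); apply: eq_bigr => i _.
  by rewrite psi_dE.
rewrite (zE (fun c => 1 - c *: 'X)) (pE (fun c => 1 - c *: 'X)).
rewrite (zE (fun c => 'X - c%:P)) (pE (fun c => 'X - c%:P)).
move=> D; etransitivity; first exact: D.
rewrite big_pole mulr_sumr; apply: eq_bigr => i _ /=.
have xi0 := xn0 l i.
rewrite !pole_residue ?pn0 // /pole /=.
have -> : \prod_(j < N | (j < i)%N) omega (x l i / x l j) = E l i by [].
have -> : \prod_(j < N | (i < j)%N) omega (x l j / (q1 * x l i)) =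
    f_coef (box l i) i.
  apply: eq_bigr => j ij; rewrite x_box_eq // x_box_neq //.
  by rewrite -val_eqE /= ltn_eqF.
have -> : \prod_(j < N | (j < i)%N) omega (x l i / q1 / x l j) = E (unbox l i) i.
  apply: eq_bigr => j ji; rewrite x_unbox_eq // x_unbox_neq //.
  by rewrite -val_eqE /= gtn_eqF.
have -> : \prod_(j < N | (i < j)%N) omega (x l j / (q1 * (x l i / q1))) =
    f_coef l i.
  by apply: eq_bigr => j _; rewrite [q1 * _]mulrC divfK.
have q11 : q1 - 1 != 0 by rewrite subr_eq0 q1_neq1.
have q11' : 1 - q1 != 0 by rewrite subr_eq0 eq_sym q1_neq1.
move: (E l i) (f_coef _ i) (E _ i) (f_coef _ i) (x l i ^ n) ((x l i / q1) ^ n).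
move: (x l i) xi0 => y y0 a b c d e f.
rewrite (q2E q1_neq0 q3_neq0 q123); field.
by rewrite q11 q11' q1_neq0 q3_neq0 y0.
Qed.

End CartanResidues.

(** * Relations among the raising operators *)

Section LinearCombinators.
Variables (F : fieldType) (q1 q2 q3 : F) (V : lmodType F).
Implicit Types (f g : V -> V).

Lemma linear_comp f g : linear f -> linear g -> linear (fun v => f (g v)).
Proof. by move=> lf lg a v w; rewrite lg lf. Qed.

Lemma linear_sub f g : linear f -> linear g -> linear (fun v => f v - g v).
Proof.
move=> lf lg a v w; rewrite lf lg scalerBr opprD addrACA; congr (_ + _).
Qed.

Lemma linear_zero : linear (fun _ : V => 0 : V).
Proof. by move=> a v w; rewrite scaler0 addr0. Qed.

Lemma linear_opp f : linear f -> linear (fun v => - f v).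
Proof. by move=> lf a v w; rewrite lf opprD scalerN. Qed.

Lemma linear_scale c f : linear f -> linear (fun v => c *: f v).
Proof. by move=> lf a v w; rewrite lf scalerDr !scalerA mulrC. Qed.

Lemma linear_comm f g : linear f -> linear g -> linear (comm_op f g).
Proof. by move=> lf lg; apply: linear_sub; apply: linear_comp. Qed.

Lemma comm_op3E (f g h : {linear V -> V}) v :
  comm_op f (comm_op g h) v = f (g (h v)) - f (h (g v)) - g (h (f v)) + h (g (f v)).
Proof. by rewrite /comm_op linearB opprB addrA addrAC. Qed.

Lemma linear_gzw (X : int -> int -> V -> V) m n :
  (forall i j, linear (X i j)) ->
  linear (fun v => gzw q1 q2 q3 (fun i j => X i j v) m n).
Proof.
move=> lX a v w; rewrite /gzw scaler_sumr -big_split; apply: eq_bigr => s _.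
by rewrite lX scalerDr !scalerA mulrC.
Qed.

Lemma linear_gwz (X : int -> int -> V -> V) m n :
  (forall i j, linear (X i j)) ->
  linear (fun v => gwz q1 q2 q3 (fun i j => X i j v) m n).
Proof.
move=> lX a v w; rewrite /gwz scaler_sumr -big_split; apply: eq_bigr => s _.
by rewrite lX scalerDr !scalerA mulrC.
Qed.

(** Each of the six permuted sums equals the original one. *)
Lemma sum_orbits3_eq0 (I : finType) (T : I -> I -> I -> V) :
    6%:R != 0 :> F ->
    (forall a b c, T a b c + T a c b + T b a c + T b c a + T c a b + T c b a = 0) ->
  \sum_a \sum_b \sum_c T a b c = 0.
Proof.
move=> n6 T0; set S := (X in X = 0).
suff /eqP : 6%:R *: S = 0 by rewrite scaler_eq0 (negPf n6) => /eqP.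
have e1 : \sum_a \sum_b \sum_c T a c b = S.
  by apply: eq_bigr => a _; rewrite exchange_big.
have e2 : \sum_a \sum_b \sum_c T b a c = S by rewrite exchange_big.
have e3 : \sum_a \sum_b \sum_c T b c a = S.
  by rewrite exchange_big -e1; apply: eq_bigr => a _; apply: eq_bigr.
have e4 : \sum_a \sum_b \sum_c T c a b = S.
  rewrite -e2; apply: eq_bigr => a _; rewrite exchange_big.
  by apply: eq_bigr.
have e5 : \sum_a \sum_b \sum_c T c b a = S.
  rewrite -e3; apply: eq_bigr => a _; rewrite exchange_big.
  by apply: eq_bigr.
transitivity (\sum_a \sum_b \sum_c
    (T a b c + T a c b + T b a c + T b c a + T c a b + T c b a)); last first.
  by do 3![apply: big1 => ? _].
under eq_bigr do under eq_bigr do rewrite !big_split.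
under eq_bigr do rewrite !big_split.
rewrite !big_split /= e1 e2 e3 e4 e5 -/S.
by rewrite scaler_nat !mulrSr mulr0n add0r.
Qed.

End LinearCombinators.

Section RaisingOperators.
Variables (F : fieldType) (N k r : nat) (q1 q2 q3 u : F).
Hypotheses (k_ge1 : (1 <= k)%N) (r_ge2 : (2 <= r)%N).
Hypotheses (u_neq0 : u != 0) (q1_neq0 : q1 != 0) (q3_neq0 : q3 != 0).
Hypothesis q123 : q1 * q2 * q3 = 1.
Hypothesis only_resonance : forall n m : int,
  q1 ^ n * q3 ^ m = 1 <->
  exists a : int, n = (1 - r%:Z) * a /\ m = (k%:Z + 1) * a.

Local Notation weight := {ffun 'I_N -> int}.
Local Notation V := {malg F[weight]}.
Local Notation adm := (@admissible N k r).
Local Notation W := (@Wkr N F k r).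
Local Notation x := (@psi_c N F q1 q3 u).
Local Notation g := (gq q1 q2 q3).
Local Notation C l i := (qvalue q1 q3 (e_frac l i)).
Local Notation "c $ l" := (c *: (<< l >> : V)) (at level 39, l at level 8).
Implicit Types (l : weight) (i j a b c : 'I_N) (v : V).

Let xn0 := @x_neq0 F N q1 q3 u u_neq0 q1_neq0 q3_neq0.
Variable cE : F.

(** Any family of operators with the matrix coefficients of [e], up to a common
    scalar: besides [e] itself this covers the conjugate of [f] by the duality. *)
Variable e : int -> {linear V -> V}.
Hypothesis e_basis : forall n l,
  e n << l >> = \sum_(i < N) (cE * (C l i * x l i ^ n)) $ (box l i).

Lemma ee_basis m n l : e m (e n << l >>) =
  \sum_(a < N) \sum_(b < N)
    (cE ^+ 2 * (C l a * C (box l a) b) * (x l a ^ n * x (box l a) b ^ m))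
      $ (box (box l a) b).
Proof.
rewrite (e_basis n l) linear_sum; apply: eq_bigr => a _.
rewrite linearZZ (e_basis m (box l a)) scaler_sumr; apply: eq_bigr => b _.
by rewrite scalerA; congr (_ *: _); ring.
Qed.

Lemma eee_basis p m n l : e p (e m (e n << l >>)) =
  \sum_(a < N) \sum_(b < N) \sum_(c < N)
    (cE ^+ 3 * (C l a * C (box l a) b * C (box (box l a) b) c) *
     (x l a ^ n * x (box l a) b ^ m * x (box (box l a) b) c ^ p))
      $ (box (box (box l a) b) c).
Proof.
rewrite (e_basis n l) !linear_sum; apply: eq_bigr => a _.
rewrite !linearZZ (ee_basis p m (box l a)) scaler_sumr.
apply: eq_bigr => b _; rewrite scaler_sumr; apply: eq_bigr => c _.
by rewrite scalerA; congr (_ *: _); ring.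
Qed.

Lemma e_stable n v : W v -> W (e n v).
Proof.
apply: linear_span_stable => l al; rewrite e_basis; apply: span_of_sum => i _.
have [aal|naal] := boolP (adm (box l i)); first exact/span_ofZ/span_of_basis.
rewrite (e_fracE k_ge1 r_ge2 u_neq0 q1_neq0 q3_neq0 only_resonance i al).
rewrite (e_coef_not_adm k_ge1 r_ge2 u_neq0 q1_neq0 q3_neq0 only_resonance al naal).
by rewrite mul0r mulr0 scale0r; apply: span_of0.
Qed.

Lemma gzw_ee m n l :
  gzw q1 q2 q3 (fun i j : int => e i (e j << l >>)) m n =
  \sum_(a < N) \sum_(b < N)
    (cE ^+ 2 * (C l a * C (box l a) b) * (x l a ^ n * x (box l a) b ^ m) *
     g (x (box l a) b) (x l a)) $ (box (box l a) b).
Proof.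
rewrite /gzw; under eq_bigr do rewrite ee_basis scaler_sumr.
rewrite exchange_big; apply: eq_bigr => a _.
under eq_bigr do rewrite scaler_sumr.
rewrite exchange_big; apply: eq_bigr => b _.
rewrite -gpoly_gq mulr_sumr scaler_suml; apply: eq_bigr => s _.
rewrite scalerA !expfzDr //; congr (_ *: _).
by rewrite -!exprnP; ring.
Qed.

Lemma rel_ee_basis m n l : adm l ->
  gzw q1 q2 q3 (fun i j : int => e i (e j << l >>)) m n =
  - gwz q1 q2 q3 (fun i j : int => e j (e i << l >>)) m n.
Proof.
move=> al;
  rewrite -[gwz _ _ _ _ _ _]/(gzw q1 q2 q3 (fun i j : int => e i (e j << l >>)) n m).
rewrite !gzw_ee [in RHS]exchange_big -sumrN; apply: eq_bigr => j _.
rewrite -sumrN; apply: eq_bigr => i _; rewrite -scaleNr boxC; congr (_ *: _).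
case: (i =P j) => [->|/eqP ij].
  by rewrite x_box_eq // /gq; ring.
have ji : j != i by rewrite eq_sym.
rewrite !x_box_neq //.
have := e_exchange k_ge1 r_ge2 u_neq0 q1_neq0 q3_neq0 q123 only_resonance al ij.
set g1 := g _ _; set g2 := g _ _; set c1 := C l j * _; set c2 := C l i * _ => ex.
transitivity (cE ^+ 2 * (x l j ^ n * x l i ^ m) * (g1 * c1)); first by ring.
by rewrite ex; ring.
Qed.

Lemma rel_ee_W m n v : W v ->
  gzw q1 q2 q3 (fun i j : int => e i (e j v)) m n =
  - gwz q1 q2 q3 (fun i j : int => e j (e i v)) m n.
Proof.
apply: (@linear_span_eq _ _ _ _
  (fun v => gzw q1 q2 q3 (fun i j : int => e i (e j v)) m n)
  (fun v => - gwz q1 q2 q3 (fun i j : int => e j (e i v)) m n)) => [||l al];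
  last exact: rel_ee_basis.
  by apply: (@linear_gzw _ _ _ _ _ (fun (i j : int) v => e i (e j v))) => i j a f g;
    rewrite !linearP.
apply: (@linear_opp _ _ (fun v => gwz q1 q2 q3 (fun i j : int => e j (e i v)) m n)).
by apply: (@linear_gwz _ _ _ _ _ (fun (i j : int) v => e j (e i v))) => i j a f g;
  rewrite !linearP.
Qed.

Lemma rel_serre_e_W v : 6%:R != 0 :> F -> W v ->
  comm_op (e 0) (comm_op (e 1) (e (-1))) v = 0.
Proof.
move=> n6; apply: (@linear_span_eq _ _ _ _
  (comm_op (e 0) (comm_op (e 1) (e (-1)))) (fun=> 0)) => [||l al].
- by move=> a f g; rewrite (linear_comm (linearP (e 0)) (linear_comm
    (linearP (e 1)) (linearP (e (-1))))).
- exact: linear_zero.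
pose T a b c : V := (cE ^+ 3 * serre_path q1 q3 u l a b c) $ (box (box (box l a) b) c).
transitivity (\sum_(a < N) \sum_(b < N) \sum_(c < N) T a b c).
  rewrite comm_op3E !eee_basis -!sumrB -big_split.
  apply: eq_bigr => a _; rewrite /= -!sumrB -big_split.
  apply: eq_bigr => b _; rewrite /= -!sumrB -big_split.
  apply: eq_bigr => c _; rewrite /= -!scalerBl -scalerDl; congr (_ *: _).
  by rewrite !expr0z !exprN1 !expr1z /serre_path /serre_weight; ring.
apply: sum_orbits3_eq0 => // a b c; rewrite /T.
have e1 := boxC (box l a) c b; have e2 := boxC l b a; have e3 := boxC l c a.
have e4 := boxC (box l b) c a; have e5 := boxC l c b.
rewrite e1 e2 e4 e2 e3 e1 e5 e4 e2 -!scalerDl -!mulrDr.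
have := serre_orbit_eq0 k_ge1 r_ge2 u_neq0 q1_neq0 q3_neq0 q123 only_resonance
  a b c al.
by rewrite /serre_orbit => ->; rewrite mulr0 scale0r.
Qed.

End RaisingOperators.

(** * The duality exchanging raising and lowering operators *)

Section Conjugation.
Variables (F : fieldType) (q1 q2 q3 : F) (V : lmodType F) (W : V -> Prop).
Variables (D : {linear V -> V}) (f t : int -> {linear V -> V}).
Hypotheses (DK : forall v, D (D v) = v) (DW : forall v, W v -> W (D v)).
Hypothesis ftE : forall n v, f n v = D (t (- n) (D v)).

Lemma conjugate_stable :
  (forall n v, W v -> W (t n v)) -> forall n v, W v -> W (f n v).
Proof. by move=> tW n v Wv; rewrite ftE; apply/DW/tW/DW. Qed.

Lemma conjugate2 m n v : f m (f n v) = D (t (- m) (t (- n) (D v))).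
Proof. by rewrite !ftE DK. Qed.

Lemma conjugate3 m n p v :
  f m (f n (f p v)) = D (t (- m) (t (- n) (t (- p) (D v)))).
Proof. by rewrite conjugate2 ftE DK. Qed.

(** Inverting both variables turns [g(z, w)] into [g(w, z) / (z * w) ^ 3], whence
    the shift by 3. *)
Lemma conjugate_gwz m n v :
  gwz q1 q2 q3 (fun i j : int => f i (f j v)) m n =
  D (gzw q1 q2 q3 (fun i j : int => t i (t j (D v))) (- m - 3) (- n - 3)).
Proof.
rewrite /gwz /gzw linear_sum; apply: eq_bigr => s _.
rewrite [RHS]linearZZ conjugate2; have := ltn_ord s => s4.
have -> : - (m + (3 - s)%N%:Z) = - m - 3 + s%:Z by lia.
by have -> : - (n + s%:Z) = - n - 3 + (3 - s)%N%:Z by lia.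
Qed.

Lemma conjugate_exchange :
  (forall m n v, W v -> gzw q1 q2 q3 (fun i j : int => t i (t j v)) m n =
     - gwz q1 q2 q3 (fun i j : int => t j (t i v)) m n) ->
  forall m n v, W v -> gwz q1 q2 q3 (fun i j : int => f i (f j v)) m n =
     - gzw q1 q2 q3 (fun i j : int => f j (f i v)) m n.
Proof.
move=> tt m n v Wv.
transitivity (- gwz q1 q2 q3 (fun i j : int => f i (f j v)) n m); last by [].
by rewrite !conjugate_gwz tt ?linearN //; apply: DW.
Qed.

Lemma conjugate_serre :
  (forall v, W v -> comm_op (t 0) (comm_op (t 1) (t (-1))) v = 0) ->
  forall v, W v -> comm_op (f 0) (comm_op (f 1) (f (-1))) v = 0.
Proof.
move=> tS v Wv; have := tS _ (DW Wv).
move/(congr1 (fun w => - D w)); rewrite linear0 oppr0 => <-.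
rewrite !comm_op3E !conjugate3 opprK oppr0 linearD !linearB !opprD !opprK.
move: (D _) (D _) (D _) (D _) => a b c d.
by rewrite (addrC d) addrAC.
Qed.

End Conjugation.

Section Duality.
Variables (F : fieldType) (N k r : nat) (q1 q2 q3 u : F).
Hypotheses (k_ge1 : (1 <= k)%N) (r_ge2 : (2 <= r)%N).
Hypotheses (u_neq0 : u != 0) (q1_neq0 : q1 != 0) (q3_neq0 : q3 != 0).
Hypothesis q123 : q1 * q2 * q3 = 1.
Hypothesis only_resonance : forall n m : int,
  q1 ^ n * q3 ^ m = 1 <->
  exists a : int, n = (1 - r%:Z) * a /\ m = (k%:Z + 1) * a.

Local Notation weight := {ffun 'I_N -> int}.
Local Notation V := {malg F[weight]}.
Local Notation adm := (@admissible N k r).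
Local Notation W := (@Wkr N F k r).
Local Notation x := (@psi_c N F q1 q3 u).
Implicit Types (l : weight) (i j : 'I_N) (v : V).

Definition dual l : weight := [ffun i => - l (rev_ord i)].

Lemma dualK : involutive dual.
Proof. by move=> l; apply/ffunP => i; rewrite !ffunE rev_ordK opprK. Qed.

Lemma dual_unbox l i : dual (unbox l i) = box (dual l) (rev_ord i).
Proof.
apply/ffunP => j; rewrite boxE !ffunE opprB addrC; congr (_ + _).
by congr (nat_of_bool _)%:Z; apply/eqP/eqP => [->|<-]; rewrite rev_ordK.
Qed.

Lemma dual_adm_imp l : adm l -> adm (dual l).
Proof.
case/admissibleP=> lp lr; apply/admissibleP; split=> i j; rewrite !ffunE => ij.
  by rewrite lerN2; apply: lp => /=; lia.
rewrite opprK addrC; apply: lr => /=; have := ltn_ord j; lia.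
Qed.

Lemma dual_adm l : adm (dual l) = adm l.
Proof.
by apply/idP/idP => /dual_adm_imp //; rewrite dualK.
Qed.

(** Chosen so that the position of the dual column is [q1 / x_i], the inverse of
    the position [x_i / q1] at which [f] removes a box. *)
Definition u_dual : F := q1 * q3 ^ (1 - N%:Z) / u.

Lemma u_dual_neq0 : u_dual != 0.
Proof. by rewrite /u_dual !mulf_neq0 ?invr_eq0 ?expfz_neq0. Qed.

Local Notation xd := (@psi_c N F q1 q3 u_dual).

Lemma x_dual l i : xd (dual l) (rev_ord i) = q1 / x l i.
Proof.
rewrite /psi_c /u_dual ffunE rev_ordK.
have -> : q3 ^ (rev_ord i)%:Z = q3 ^ (N%:Z - 1) * (q3 ^ i%:Z)^-1.
  rewrite invr_expz -expfzDr //; congr (_ ^ _) => /=; have := ltn_ord i; lia.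
have -> : q3 ^ (1 - N%:Z) = (q3 ^ (N%:Z - 1))^-1.
  by rewrite invr_expz opprB.
rewrite -invr_expz.
have := expfz_neq0 (N%:Z - 1) q3_neq0; have := expfz_neq0 i%:Z q3_neq0.
have := expfz_neq0 (l i) q1_neq0.
move: (q1 ^ l i) (q3 ^ i%:Z) (q3 ^ (N%:Z - 1)) => a b c a0 b0 c0.
by field; rewrite a0 b0 c0 u_neq0.
Qed.

Lemma perm_rev_ord i :
  perm_eq [seq j : 'I_N <- enum 'I_N | (i < j)%N]
    [seq rev_ord j | j : 'I_N <- enum 'I_N & (j < rev_ord i)%N].
Proof.
apply: uniq_perm => [||j].
- by rewrite filter_uniq ?enum_uniq.
- by rewrite map_inj_uniq; [rewrite filter_uniq ?enum_uniq | apply: rev_ord_inj].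
rewrite mem_filter mem_enum andbT.
rewrite -[in RHS](rev_ordK j) (mem_map rev_ord_inj) mem_filter mem_enum andbT /=.
by have := ltn_ord i; have := ltn_ord j; lia.
Qed.

Lemma f_frac_dual l i :
  perm_eq (qnum (f_frac l i)) (qnum (e_frac (dual l) (rev_ord i))) /\
  perm_eq (qden (f_frac l i)) (qden (e_frac (dual l) (rev_ord i))).
Proof.
have expo j : [/\ dual l (rev_ord i) - dual l j = l (rev_ord j) - l i
    & (rev_ord i)%:Z - j%:Z = (rev_ord j)%:Z - i%:Z].
  rewrite !ffunE rev_ordK opprK addrC; split=> //=.
  by have := ltn_ord i; have := ltn_ord j; lia.
split.
- rewrite [X in perm_eq _ (flatten X)](_ : _ = [seq pair_num l j i |
      j <- [seq rev_ord j | j : 'I_N <- enum 'I_N & (j < rev_ord i)%N]]).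
    by apply/perm_flatten/perm_map/perm_rev_ord.
  rewrite -map_comp; apply: eq_map => j; rewrite /pair_num /comp.
  by have [-> ->] := expo j.
- rewrite [X in perm_eq _ (flatten X)](_ : _ = [seq pair_den l j i |
      j <- [seq rev_ord j | j : 'I_N <- enum 'I_N & (j < rev_ord i)%N]]).
    by apply/perm_flatten/perm_map/perm_rev_ord.
  rewrite -map_comp; apply: eq_map => j; rewrite /pair_den /comp.
  by have [-> ->] := expo j.
Qed.

Lemma f_qvalue_dual l i :
  qvalue q1 q3 (f_frac l i) = qvalue q1 q3 (e_frac (dual l) (rev_ord i)).
Proof.
by have [pn pd] := f_frac_dual l i; case: (perm_qvalue q1 q3 pn pd).
Qed.

Lemma f_qregular l i : adm l -> qregular q1 q3 (f_frac l i).
Proof.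
rewrite -dual_adm => al; have [pn pd] := f_frac_dual l i.
have [_ ->] := perm_qvalue q1 q3 pn pd.
by have [] := e_fracP k_ge1 r_ge2 u_neq0 q1_neq0 q3_neq0 only_resonance
  (rev_ord i) al.
Qed.

Lemma f_coef_dual l i :
  f_coef q1 q3 u l i = e_coef q1 q3 u_dual (dual l) (rev_ord i).
Proof.
rewrite /f_coef /e_coef (reindex_inj rev_ord_inj) /=; apply: eq_big => j.
  by rewrite /=; have := ltn_ord i; have := ltn_ord j; lia.
move=> _; congr (omega _ _ _); rewrite -{2}(rev_ordK j) !x_dual.
have := x_neq0 u_neq0 q1_neq0 q3_neq0 l i.
have := x_neq0 u_neq0 q1_neq0 q3_neq0 l (rev_ord j).
by move: (x l _) (x l _) => a b a0 b0; field; rewrite ?a0 ?b0 ?q1_neq0.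
Qed.

Lemma f_fracE l i : adm l -> qvalue q1 q3 (f_frac l i) = f_coef q1 q3 u l i.
Proof.
rewrite -dual_adm => al; rewrite f_qvalue_dual f_coef_dual.
exact: (e_fracE k_ge1 r_ge2 u_dual_neq0 q1_neq0 q3_neq0 only_resonance).
Qed.

Lemma f_coef_not_adm l i : adm l -> ~~ adm (unbox l i) -> f_coef q1 q3 u l i = 0.
Proof.
rewrite -dual_adm -(dual_adm (unbox l i)) dual_unbox f_coef_dual.
exact: (e_coef_not_adm k_ge1 r_ge2 u_dual_neq0 q1_neq0 q3_neq0 only_resonance).
Qed.

Definition dual_op : {linear V -> V} := linext (fun l => << dual l >>).

Lemma dual_op_basis l : dual_op << l >> = << dual l >>.
Proof. exact: linext_basis. Qed.

Lemma dual_opK v : dual_op (dual_op v) = v.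
Proof.
apply: (@linear_span_eq _ _ predT _ (fun v => dual_op (dual_op v)) id).
- by move=> a w w'; rewrite !linearP.
- by move=> a w w'.
- by move=> l _; rewrite !dual_op_basis dualK.
- by apply/span_ofP.
Qed.

Lemma dual_op_stable v : W v -> W (dual_op v).
Proof.
apply: linear_span_stable => l al; rewrite dual_op_basis.
by apply: span_of_basis; rewrite dual_adm.
Qed.

Variables (cF : F) (f : int -> {linear V -> V}).
Hypothesis f_basis : forall n l,
  f n << l >> = \sum_(i < N)
    (cF * (qvalue q1 q3 (f_frac l i) * (x l i / q1) ^ n)) *: << unbox l i >>.

Definition dual_f (n : int) : {linear V -> V} := dual_op \o (f (- n) \o dual_op).

Lemma dual_f_def n v : dual_f n v = dual_op (f (- n) (dual_op v)).
Proof. by []. Qed.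

Lemma dual_fE n v : f n v = dual_op (dual_f (- n) (dual_op v)).
Proof. by rewrite dual_f_def !dual_opK opprK. Qed.

Lemma dual_f_basis n l : dual_f n << l >> =
  \sum_(i < N) (cF * (qvalue q1 q3 (e_frac l i) * xd l i ^ n)) *: << box l i >>.
Proof.
rewrite dual_f_def dual_op_basis f_basis linear_sum (reindex_inj rev_ord_inj).
apply: eq_bigr => i _; rewrite linearZZ dual_op_basis dual_unbox f_qvalue_dual.
rewrite dualK rev_ordK; congr ((_ * (_ * _)) *: _).
rewrite -[xd l i](_ : xd (dual (dual l)) (rev_ord (rev_ord i)) = _); last first.
  by rewrite dualK rev_ordK.
by rewrite x_dual -exprz_inv invf_div.
Qed.

Lemma f_stable n v : W v -> W (f n v).
Proof.
apply: (conjugate_stable dual_op_stable dual_fE); apply: e_stable k_ge1 r_ge2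
  u_dual_neq0 q1_neq0 q3_neq0 only_resonance _ _ dual_f_basis.
Qed.

Lemma rel_ff_W m n v : W v ->
  gwz q1 q2 q3 (fun a b : int => f a (f b v)) m n =
  - gzw q1 q2 q3 (fun a b : int => f b (f a v)) m n.
Proof.
apply: (conjugate_exchange dual_opK dual_op_stable dual_fE).
apply: rel_ee_W k_ge1 r_ge2 u_dual_neq0 q1_neq0 q3_neq0 q123 only_resonance
  _ _ dual_f_basis.
Qed.

Lemma rel_serre_f_W v : 6%:R != 0 :> F -> W v ->
  comm_op (f 0) (comm_op (f 1) (f (-1))) v = 0.
Proof.
move=> n6; apply: (conjugate_serre dual_opK dual_op_stable dual_fE) => w Ww.
exact: (rel_serre_e_W k_ge1 r_ge2 u_dual_neq0 q1_neq0 q3_neq0 q123 only_resonance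
  dual_f_basis n6 Ww).
Qed.

End Duality.

(** * Cartan currents and the commutator of raising and lowering operators *)

Section CartanOperators.
Variables (F : fieldType) (N : nat) (q1 q2 q3 u : F).
Hypotheses (u_neq0 : u != 0) (q1_neq0 : q1 != 0) (q3_neq0 : q3 != 0).

Local Notation weight := {ffun 'I_N -> int}.
Local Notation V := {malg F[weight]}.
Local Notation x := (@psi_c N F q1 q3 u).
Local Notation G s := ((gpoly q1 q2 q3)`_s).
Implicit Types (l : weight) (v : V).

Let xn0 := @x_neq0 F N q1 q3 u u_neq0 q1_neq0 q3_neq0.

Variables (cE cF : F) (Ec Fc : weight -> 'I_N -> F).
Variables (e f : int -> {linear V -> V}).
Hypothesis e_basis : forall n l, e n << l >> =
  \sum_(i < N) (cE * (Ec l i * x l i ^ n)) *: << box l i >>.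
Hypothesis f_basis : forall n l, f n << l >> =
  \sum_(i < N) (cF * (Fc l i * (x l i / q1) ^ n)) *: << unbox l i >>.

Variables (psi : int -> V -> V) (P : int -> weight -> F).
Hypothesis psi_linear : forall n, linear (psi n).
Hypothesis psi_basis : forall n l, psi n << l >> = P n l *: << l >>.
Hypothesis psi_exchange : forall l (i : 'I_N) (m : int),
  \sum_(s < 4) G s * (P (m + s%:Z) (box l i) * x l i ^+ (3 - s)) =
  - \sum_(s < 4) G s * (P (m + (3 - s)%N%:Z) l * x l i ^+ s).

Lemma psi_sum (I : finType) n (c : I -> F) (w : I -> V) :
  psi n (\sum_i c i *: w i) = \sum_i c i *: psi n (w i).
Proof.
have p0 : psi n 0 = 0.
  by have := psi_linear n (-1) 0 0; rewrite scaler0 addr0 scaleN1r addNr.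
elim/big_rec2: _ => // i w1 w2 _ <-; exact: psi_linear.
Qed.

Lemma psi_e_basis m n l :
  gzw q1 q2 q3 (fun i j : int => psi i (e j << l >>)) m n =
  - gwz q1 q2 q3 (fun i j : int => e j (psi i << l >>)) m n.
Proof.
have lhs : gzw q1 q2 q3 (fun i j : int => psi i (e j << l >>)) m n =
    \sum_(i < N) (cE * (Ec l i * x l i ^ n) *
    \sum_(s < 4) G s * (P (m + s%:Z) (box l i) * x l i ^+ (3 - s))) *: << box l i >>.
  rewrite /gzw; under eq_bigr do rewrite e_basis psi_sum scaler_sumr.
  rewrite exchange_big; apply: eq_bigr => i _.
  rewrite mulr_sumr scaler_suml; apply: eq_bigr => s _.
  by rewrite psi_basis !scalerA expfzDr // -exprnP; congr (_ *: _); ring.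
have rhs : gwz q1 q2 q3 (fun i j : int => e j (psi i << l >>)) m n =
    \sum_(i < N) (cE * (Ec l i * x l i ^ n) *
    \sum_(s < 4) G s * (P (m + (3 - s)%N%:Z) l * x l i ^+ s)) *: << box l i >>.
  rewrite /gwz.
  under eq_bigr do rewrite psi_basis linearZZ e_basis scalerA scaler_sumr.
  rewrite exchange_big; apply: eq_bigr => i _.
  rewrite mulr_sumr scaler_suml; apply: eq_bigr => s _.
  by rewrite !scalerA expfzDr // -exprnP; congr (_ *: _); ring.
rewrite lhs rhs -sumrN; apply: eq_bigr => i _.
by rewrite psi_exchange mulrN scaleNr.
Qed.

Lemma psi_f_basis m n l :
  gwz q1 q2 q3 (fun i j : int => psi i (f j << l >>)) m n =
  - gzw q1 q2 q3 (fun i j : int => f j (psi i << l >>)) m n.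
Proof.
have w0 i : x l i / q1 != 0 by rewrite mulf_neq0 ?invr_eq0.
have lhs : gwz q1 q2 q3 (fun i j : int => psi i (f j << l >>)) m n =
    \sum_(i < N) (cF * (Fc l i * (x l i / q1) ^ n) *
    \sum_(s < 4) G s * (P (m + (3 - s)%N%:Z) (unbox l i) * (x l i / q1) ^+ s))
      *: << unbox l i >>.
  rewrite /gwz; under eq_bigr do rewrite f_basis psi_sum scaler_sumr.
  rewrite exchange_big; apply: eq_bigr => i _.
  rewrite mulr_sumr scaler_suml; apply: eq_bigr => s _.
  by rewrite psi_basis !scalerA expfzDr // -exprnP; congr (_ *: _); ring.
have rhs : gzw q1 q2 q3 (fun i j : int => f j (psi i << l >>)) m n =
    \sum_(i < N) (cF * (Fc l i * (x l i / q1) ^ n) *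
    \sum_(s < 4) G s * (P (m + s%:Z) l * (x l i / q1) ^+ (3 - s)))
      *: << unbox l i >>.
  rewrite /gzw.
  under eq_bigr do rewrite psi_basis linearZZ f_basis scalerA scaler_sumr.
  rewrite exchange_big; apply: eq_bigr => i _.
  rewrite mulr_sumr scaler_suml; apply: eq_bigr => s _.
  by rewrite !scalerA expfzDr // -exprnP; congr (_ *: _); ring.
rewrite lhs rhs -sumrN; apply: eq_bigr => i _.
have := psi_exchange (unbox l i) i m; rewrite unboxK x_unbox_eq // => ->.
by rewrite mulrN scaleNr opprK.
Qed.

Variable S : pred weight.

Lemma psi_e_span m n v : span_of S v ->
  gzw q1 q2 q3 (fun i j : int => psi i (e j v)) m n =
  - gwz q1 q2 q3 (fun i j : int => e j (psi i v)) m n.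
Proof.
apply: (@linear_span_eq _ _ S _
  (fun v => gzw q1 q2 q3 (fun i j : int => psi i (e j v)) m n)
  (fun v => - gwz q1 q2 q3 (fun i j : int => e j (psi i v)) m n)) => [||l _].
- by apply: (@linear_gzw _ _ _ _ _ (fun (i j : int) v => psi i (e j v)))
    => i j a w w'; rewrite linearP psi_linear.
- apply: (@linear_opp _ _ (fun v => gwz q1 q2 q3 (fun i j : int => e j (psi i v)) m n)).
  by apply: (@linear_gwz _ _ _ _ _ (fun (i j : int) v => e j (psi i v)))
    => i j a w w'; rewrite psi_linear linearP.
exact: psi_e_basis.
Qed.

Lemma psi_f_span m n v : span_of S v ->
  gwz q1 q2 q3 (fun i j : int => psi i (f j v)) m n =
  - gzw q1 q2 q3 (fun i j : int => f j (psi i v)) m n.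
Proof.
apply: (@linear_span_eq _ _ S _
  (fun v => gwz q1 q2 q3 (fun i j : int => psi i (f j v)) m n)
  (fun v => - gzw q1 q2 q3 (fun i j : int => f j (psi i v)) m n)) => [||l _].
- by apply: (@linear_gwz _ _ _ _ _ (fun (i j : int) v => psi i (f j v)))
    => i j a w w'; rewrite linearP psi_linear.
- apply: (@linear_opp _ _ (fun v => gzw q1 q2 q3 (fun i j : int => f j (psi i v)) m n)).
  by apply: (@linear_gzw _ _ _ _ _ (fun (i j : int) v => f j (psi i v)))
    => i j a w w'; rewrite psi_linear linearP.
exact: psi_f_basis.
Qed.

End CartanOperators.

Section Commutator.
Variables (F : fieldType) (N k r : nat) (q1 q2 q3 u : F).
Hypotheses (k_ge1 : (1 <= k)%N) (r_ge2 : (2 <= r)%N).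
Hypotheses (u_neq0 : u != 0) (q1_neq0 : q1 != 0) (q3_neq0 : q3 != 0).
Hypothesis q123 : q1 * q2 * q3 = 1.
Hypothesis only_resonance : forall n m : int,
  q1 ^ n * q3 ^ m = 1 <->
  exists a : int, n = (1 - r%:Z) * a /\ m = (k%:Z + 1) * a.

Local Notation weight := {ffun 'I_N -> int}.
Local Notation V := {malg F[weight]}.
Local Notation adm := (@admissible N k r).
Local Notation x := (@psi_c N F q1 q3 u).
Local Notation E := (e_coef q1 q3 u).
Local Notation Fc := (f_coef q1 q3 u).
Local Notation C l i := (qvalue q1 q3 (e_frac l i)).
Local Notation D l i := (qvalue q1 q3 (f_frac l i)).
Implicit Types (l : weight) (i j : 'I_N) (v : V).

Let fE := @f_fracE F N k r q1 q3 u k_ge1 r_ge2 u_neq0 q1_neq0 q3_neq0 only_resonance.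
Let eE := @e_fracE F N k r q1 q3 u k_ge1 r_ge2 u_neq0 q1_neq0 q3_neq0 only_resonance.

Lemma unboxNE l i j : j != i -> unbox l i j = l j.
Proof. by move=> ji; rewrite -[in RHS](unboxK l i) boxNE. Qed.

(** For [j < i] the factor of this pair of columns occurs in both coefficients, and
    the operator applied last sees it changed; the changed and the unchanged
    value are the same in the two orders. *)
Lemma ef_coef_exchange l i j : i != j ->
  Fc l j * E (unbox l j) i = E l i * Fc (box l i) j.
Proof.
move=> ij; case: (ltngtP i j) => [lt|lt|/val_inj e]; last by rewrite e eqxx in ij.
  have -> : E (unbox l j) i = E l i.
    apply: e_coef_ext => c ci; rewrite unboxNE // -val_eqE /= ltn_eqF //.
    exact: leq_ltn_trans ci lt.
  have -> : Fc (box l i) j = Fc l j.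
    apply: eq_bigr => c jc; rewrite !x_box_neq // -val_eqE /= ltn_eqF //.
    exact: ltn_trans lt jc.
  exact: mulrC.
have ji : j != i by rewrite eq_sym.
rewrite (@e_coef_split1 _ _ _ _ _ l (unbox l j) i j) //; last first.
  by move=> c cj; rewrite unboxNE.
rewrite (@e_coef_split1 _ _ _ _ _ l l i j) // x_unbox_eq //.
rewrite /f_coef (bigD1 i) //= [in RHS](bigD1 i) //=.
rewrite x_box_eq // x_box_neq //.
rewrite [in RHS](eq_bigr (fun c => omega q1 q3 (x l c / x l j))); last first.
  by move=> c /andP[_ ci]; rewrite x_box_neq // eq_sym.
have -> : x l i / (x l j / q1) = q1 * x l i / x l j.
  have := x_neq0 u_neq0 q1_neq0 q3_neq0 l j; move: (x l i) (x l j) => y z z0.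
  by field; rewrite z0 q1_neq0.
by ring.
Qed.

Lemma fe_path l i j : adm l -> D l j * C (unbox l j) i = Fc l j * E (unbox l j) i.
Proof.
move=> al; rewrite fE //; have [aul|naul] := boolP (adm (unbox l j)).
  by rewrite eE.
by rewrite (f_coef_not_adm k_ge1 r_ge2 u_neq0 q1_neq0 q3_neq0 only_resonance
  al naul) !mul0r.
Qed.

Lemma ef_path l i j : adm l -> C l i * D (box l i) j = E l i * Fc (box l i) j.
Proof.
move=> al; rewrite eE //; have [abl|nabl] := boolP (adm (box l i)).
  by rewrite fE.
by rewrite (e_coef_not_adm k_ge1 r_ge2 u_neq0 q1_neq0 q3_neq0 only_resonance
  al nabl) !mul0r.
Qed.

Lemma gpoly1 : (gpoly q1 q2 q3).[1] = (1 - q1) * (1 - q2) * (1 - q3).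
Proof. by rewrite /gpoly !hornerE. Qed.

Variables (cE cF : F) (e f : int -> {linear V -> V}).
Hypothesis cEF : cE * cF = q1 / (1 - q1) ^+ 2.
Hypothesis e_basis : forall n l, e n << l >> =
  \sum_(i < N) (cE * (C l i * x l i ^ n)) *: << box l i >>.
Hypothesis f_basis : forall n l, f n << l >> =
  \sum_(i < N) (cF * (D l i * (x l i / q1) ^ n)) *: << unbox l i >>.

Lemma comm_ef_basis m n l : adm l -> comm_op (e m) (f n) << l >> =
  ((gpoly q1 q2 q3).[1])^-1 *:
    ((psip_int q1 q3 u (m + n) l - psim_int q1 q3 u (m + n) l) *: << l >>).
Proof.
move=> al.
have unbox_box i j : unbox (box l i) j = box (unbox l j) i.
  by rewrite /unbox /box addrAC.
have fe : e m (f n << l >>) = \sum_(j < N) \sum_(i < N)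
    (cE * cF * (Fc l j * E (unbox l j) i) * ((x l j / q1) ^ n * x (unbox l j) i ^ m))
      *: (<< box (unbox l j) i >> : V).
  rewrite f_basis linear_sum; apply: eq_bigr => j _.
  rewrite linearZZ e_basis scaler_sumr; apply: eq_bigr => i _.
  by rewrite scalerA -(fe_path i j al); congr (_ *: _); ring.
have ef : f n (e m << l >>) = \sum_(j < N) \sum_(i < N)
    (cE * cF * (E l i * Fc (box l i) j) * ((x (box l i) j / q1) ^ n * x l i ^ m))
      *: (<< box (unbox l j) i >> : V).
  rewrite e_basis linear_sum exchange_big; apply: eq_bigr => i _.
  rewrite linearZZ f_basis scaler_sumr; apply: eq_bigr => j _.
  by rewrite scalerA -(ef_path i j al) (unbox_box i j); congr (_ *: _); ring.
rewrite /comm_op fe ef -sumrB scalerA.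
rewrite (psi_difference k_ge1 r_ge2 u_neq0 q1_neq0 q3_neq0 q123 only_resonance
  (m + n) al) mulrA.
have q11 : 1 - q1 != 0.
  by rewrite subr_eq0 eq_sym (q1_neq1 only_resonance).
have q21 : 1 - q2 != 0.
  by rewrite subr_eq0 eq_sym (q2_neq1 k_ge1 r_ge2 q123 only_resonance).
have q31 : 1 - q3 != 0.
  by rewrite subr_eq0 eq_sym (q3_neq1 r_ge2 only_resonance).
have -> : ((gpoly q1 q2 q3).[1])^-1 * ((1 - q2) * (1 - q3) * q1 / (1 - q1)) = cE * cF.
  by rewrite cEF gpoly1; field; rewrite q11 q21 q31.
rewrite mulr_sumr scaler_suml; apply: eq_bigr => i _.
rewrite -sumrB (bigD1 i) //= [X in _ + X]big1 ?addr0 => [|j ji]; last first.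
  rewrite -scalerBl ef_coef_exchange // x_box_neq // x_unbox_neq 1?eq_sym //.
  by rewrite subrr scale0r.
rewrite -scalerBl -/(box _ _) unboxK x_unbox_eq // x_box_eq //.
have xi0 := x_neq0 u_neq0 q1_neq0 q3_neq0 l i.
have w0 : x l i / q1 != 0 by rewrite mulf_neq0 ?invr_eq0.
rewrite [q1 * _]mulrC mulfK // (expfzDr _ _ w0) (expfzDr _ _ xi0).
by congr (_ *: _); ring.
Qed.

End Commutator.

(** * The module structure *)

Section Module.
Variables (F : fieldType) (N k r : nat) (q1 q2 q3 u : F).
Hypotheses (k_ge1 : (1 <= k)%N) (r_ge2 : (2 <= r)%N).
Hypotheses (u_neq0 : u != 0) (q1_neq0 : q1 != 0) (q3_neq0 : q3 != 0).
Hypothesis q123 : q1 * q2 * q3 = 1.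
Hypothesis only_resonance : forall n m : int,
  q1 ^ n * q3 ^ m = 1 <->
  exists a : int, n = (1 - r%:Z) * a /\ m = (k%:Z + 1) * a.
Hypothesis six_neq0 : 6%:R != 0 :> F.

Local Notation weight := {ffun 'I_N -> int}.
Local Notation V := {malg F[weight]}.
Local Notation W := (@Wkr N F k r).
Local Notation x := (@psi_c N F q1 q3 u).
Local Notation A := (W_action N q1 q3 u).
Implicit Types (l : weight) (v : V).

Lemma act_e_basis n l : act_e A n << l >> =
  \sum_(i < N) ((1 - q1)^-1 * (qvalue q1 q3 (e_frac l i) * x l i ^ n))
    *: << box l i >>.
Proof.
rewrite [LHS]linext_basis /e_ket scaler_sumr; apply: eq_bigr => i _.
by rewrite scalerA.
Qed.

Lemma act_f_basis n l : act_f A n << l >> =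
  \sum_(i < N) ((- (1 - q1^-1))^-1 *
     (qvalue q1 q3 (f_frac l i) * (x l i / q1) ^ n)) *: << unbox l i >>.
Proof.
rewrite [LHS]linext_basis /f_ket scaler_sumr; apply: eq_bigr => i _.
by rewrite scalerA -psi_dE.
Qed.

Lemma act_psip_basis n l : act_psip A n << l >> = psip_eig q1 q3 u n l *: << l >>.
Proof. exact: linext_basis. Qed.

Lemma act_psim_basis n l : act_psim A n << l >> = psim_eig q1 q3 u n l *: << l >>.
Proof. exact: linext_basis. Qed.

Lemma psip_coef_linear n : linear (psip_coef A n).
Proof.
by rewrite /psip_coef => a v w; case: ifP => _; rewrite ?linearP // scaler0 addr0.
Qed.

Lemma psim_coef_linear n : linear (psim_coef A n).
Proof.
by rewrite /psim_coef => a v w; case: ifP => _; rewrite ?linearP // scaler0 addr0.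
Qed.

Lemma psip_coef_basis n l : psip_coef A n << l >> = psip_int q1 q3 u n l *: << l >>.
Proof.
rewrite /psip_coef /psip_int; case: ifP => _; last by rewrite scale0r.
exact: act_psip_basis.
Qed.

Lemma psim_coef_basis n l : psim_coef A n << l >> = psim_int q1 q3 u n l *: << l >>.
Proof.
rewrite /psim_coef /psim_int; case: ifP => _; last by rewrite scale0r.
exact: act_psim_basis.
Qed.

Definition diagonal (f : V -> V) := exists c : weight -> F,
  forall l, f << l >> = c l *: << l >>.

Lemma diagonal_stable (f : {linear V -> V}) v : diagonal f -> W v -> W (f v).
Proof.
case=> c fc; apply: linear_span_stable => l al; rewrite fc.
exact/span_ofZ/span_of_basis.
Qed.

Lemma diagonal_comm (f g : {linear V -> V}) v :
  diagonal f -> diagonal g -> W v -> comm_op f g v = 0.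
Proof.
move=> [c fc] [d gd]; apply: (@linear_span_eq _ _ _ _ (comm_op f g) (fun=> 0)).
- by apply: linear_comm; apply: linearP.
- exact: linear_zero.
move=> l _; rewrite /comm_op fc gd (linearZZ f) (linearZZ g) fc gd !scalerA.
by rewrite (mulrC (c l)) subrr.
Qed.

Lemma diagonal1 (f : {linear V -> V}) v :
  (forall l, f << l >> = << l >>) -> W v -> f v = v.
Proof.
move=> f1; apply: (@linear_span_eq _ _ _ _ f id); first exact: linearP.
  by move=> a w w'.
by move=> l _; apply: f1.
Qed.

Lemma diagonal_inverse (f g : {linear V -> V}) v :
  (forall l, f << l >> = << l >>) -> (forall l, g << l >> = << l >>) ->
  W v -> f (g v) = v.
Proof. by move=> f1 g1 Wv; rewrite (diagonal1 g1 Wv) (diagonal1 f1 Wv). Qed.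

Lemma psip_diagonal n : diagonal (act_psip A n).
Proof. by eexists=> l; apply: act_psip_basis. Qed.

Lemma psim_diagonal n : diagonal (act_psim A n).
Proof. by eexists=> l; apply: act_psim_basis. Qed.

Lemma psip0V_basis l : act_psip0V A << l >> = << l >>.
Proof.
by rewrite [LHS]linext_basis psip_eig0 invr1 scale1r.
Qed.

Lemma psim0V_basis l : act_psim0V A << l >> = << l >>.
Proof.
by rewrite [LHS]linext_basis (psim_eig0 u_neq0 q1_neq0 q3_neq0 q123) invr1 scale1r.
Qed.

Lemma psip0_basis l : act_psip A 0%N << l >> = << l >>.
Proof. by rewrite act_psip_basis psip_eig0 scale1r. Qed.

Lemma psim0_basis l : act_psim A 0%N << l >> = << l >>.
Proof.
by rewrite act_psim_basis (psim_eig0 u_neq0 q1_neq0 q3_neq0 q123) scale1r.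
Qed.

Lemma comm_ef_W m n v : W v -> comm_op (act_e A m) (act_f A n) v =
  ((gpoly q1 q2 q3).[1])^-1 *: (psip_coef A (m + n) v - psim_coef A (m + n) v).
Proof.
apply: (@linear_span_eq _ _ _ _ (comm_op (act_e A m) (act_f A n))
  (fun v => ((gpoly q1 q2 q3).[1])^-1 *:
    (psip_coef A (m + n) v - psim_coef A (m + n) v))).
- by apply: linear_comm; apply: linearP.
- apply: linear_scale; apply: linear_sub.
    exact: psip_coef_linear.
  exact: psim_coef_linear.
move=> l al; rewrite psip_coef_basis psim_coef_basis -scalerBl.
apply: (comm_ef_basis k_ge1 r_ge2 u_neq0 q1_neq0 q3_neq0 q123 only_resonance
  _ act_e_basis act_f_basis m n al).
have q11 : 1 - q1 != 0 by rewrite subr_eq0 eq_sym (q1_neq1 only_resonance).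
by field; rewrite q11 q1_neq0.
Qed.

Lemma W_is_E_module : is_E_module q1 q2 q3 W A.
Proof.
have px := @psip_exchange F N q1 q2 q3 u u_neq0 q1_neq0 q3_neq0 q123.
have mx := @psim_exchange F N q1 q2 q3 u u_neq0 q1_neq0 q3_neq0 q123.
split.
- exact: (e_stable k_ge1 r_ge2 u_neq0 q1_neq0 q3_neq0 only_resonance act_e_basis).
- exact: (f_stable k_ge1 r_ge2 u_neq0 q1_neq0 q3_neq0 only_resonance act_f_basis).
- by move=> j v; apply/diagonal_stable/psip_diagonal.
- by move=> j v; apply/diagonal_stable/psim_diagonal.
- by move=> v Wv; rewrite (diagonal1 psip0V_basis Wv).
- by move=> v Wv; rewrite (diagonal1 psim0V_basis Wv).
- exact: (rel_ee_W k_ge1 r_ge2 u_neq0 q1_neq0 q3_neq0 q123 only_resonance act_e_basis).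
- exact: (rel_ff_W k_ge1 r_ge2 u_neq0 q1_neq0 q3_neq0 q123 only_resonance act_f_basis).
- move=> m n v; apply: (psi_e_span u_neq0 q1_neq0 q3_neq0 act_e_basis
    psip_coef_linear psip_coef_basis px).
- move=> m n v; apply: (psi_e_span u_neq0 q1_neq0 q3_neq0 act_e_basis
    psim_coef_linear psim_coef_basis mx).
- move=> m n v; apply: (psi_f_span u_neq0 q1_neq0 q3_neq0 act_f_basis
    psip_coef_linear psip_coef_basis px).
- move=> m n v; apply: (psi_f_span u_neq0 q1_neq0 q3_neq0 act_f_basis
    psim_coef_linear psim_coef_basis mx).
- exact: comm_ef_W.
- by move=> i j v; apply: diagonal_comm; apply: psip_diagonal.
- by move=> i j v; apply: diagonal_comm; apply: psim_diagonal.
- by move=> i j v; apply: diagonal_comm; [apply: psip_diagonal|apply: psim_diagonal].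
- by move=> v Wv; split; [exact: (diagonal_inverse psip0_basis psip0V_basis Wv)
    | exact: (diagonal_inverse psip0V_basis psip0_basis Wv)].
- by move=> v Wv; split; [exact: (diagonal_inverse psim0_basis psim0V_basis Wv)
    | exact: (diagonal_inverse psim0V_basis psim0_basis Wv)].
- move=> v; exact: (rel_serre_e_W k_ge1 r_ge2 u_neq0 q1_neq0 q3_neq0 q123
    only_resonance act_e_basis six_neq0).
- move=> v; exact: (rel_serre_f_W k_ge1 r_ge2 u_neq0 q1_neq0 q3_neq0 q123
    only_resonance act_f_basis six_neq0).
Qed.

Lemma W_has_level : has_level W A 1 1.
Proof.
move=> v Wv; rewrite !scale1r.
by rewrite (diagonal1 psip0_basis) // (diagonal1 psim0_basis).
Qed.

End Module.

Theorem lemma6p2 (R : realType) (k r N : nat) (u q1 q2 q3 : R[i])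
    (k_ge1 : (1 <= k)%N) (r_ge2 : (2 <= r)%N)
    (u_neq0 : u != 0) (q1_neq0 : q1 != 0) (q2_neq0 : q2 != 0)
    (q3_neq0 : q3 != 0) (q123 : q1 * q2 * q3 = 1)
    (resonance : q1 ^ (1 - r%:Z) * q3 ^ (k%:Z + 1) = 1)
    (only_resonance : forall n m : int,
      q1 ^ n * q3 ^ m = 1 <->
      exists a : int, n = (1 - r%:Z) * a /\ m = (k%:Z + 1) * a) :
  [/\ forall (l : {ffun 'I_N -> int}) (i : 'I_N), admissible k r l ->
        qregular q1 q3 (e_frac l i) /\ qregular q1 q3 (f_frac l i),
      is_E_module q1 q2 q3 (@Wkr N R[i] k r) (W_action N q1 q3 u)
    & has_level (@Wkr N R[i] k r) (W_action N q1 q3 u) 1 1].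
Proof.
split.
- move=> l i al; split.
    by case: (e_fracP k_ge1 r_ge2 u_neq0 q1_neq0 q3_neq0 only_resonance i al).
  exact: (f_qregular k_ge1 r_ge2 u_neq0 q1_neq0 q3_neq0 only_resonance).
- by apply: W_is_E_module; rewrite // pnatr_eq0.
- exact: (W_has_level u_neq0 q1_neq0 q3_neq0 q123).
Qed.
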